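(* Let $K$ be a field, $E$ any graph, $e=e_1\cdots e_N$ a cycle in $E$, and $p(x)\in K[x]$ a basic irreducible polynomial of degree $n\ge 2$. Let $K'=K[x]/\langle p(x)\rangle$ and $\overline{x}=x+\langle p(x)\rangle\in K'$. Then the simple left $L_K(E)$-module $V^{p}_{[e^\infty]}$ is finitely presented, and a projective resolution of $V^{p}_{[e^\infty]}$ is given by the short exact sequence of left $L_K(E)$-modules $$0\longrightarrow L_K(E)p(e)\xrightarrow{\ \iota\ } L_K(E)s(e)\xrightarrow{\ \rho_{e^\infty}\circ\sigma_{e,\overline{x}}\circ i\ } V^{p}_{[e^\infty]}\longrightarrow 0,$$ where $\iota$ is the inclusion, $i:L_K(E)s(e)\to L_{K'}(E)s(e)$ is the natural embedding of left $L_K(E)$-modules, $\sigma_{e,\overline{x}}$ is the gauge automorphism of $L_{K'}(E)$, and $\rho_{e^\infty}$ is right multiplication by $e^\infty$; that is, the second map is $\ell s(e)\mapsto \sigma_{e,\overline{x}}(\ell s(e))\,e^\infty$.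
   Context: Graphs: $E=(E^0,E^1,s,r)$ is an arbitrary directed graph. A path is a sequence of edges $f_1\cdots f_n$ with $r(f_i)=s(f_{i+1})$; vertices are paths of length $0$. A cycle is a path $e=e_1\cdots e_N$ ($N\ge1$) with $r(e_N)=s(e_1)$ and $s(e_i)\ne s(e_j)$ for $i\neq j$; $s(e)=s(e_1)$. Leavitt path algebra: $L_K(E)$ is the path $K$-algebra of the double graph (add an edge $f^*$ with $s(f^* )=r(f)$, $r(f^* )=s(f)$ for each $f\in E^1$) modulo $f^*g=\delta_{f,g}r(f)$ for $f,g\in E^1$ and $v=\sum_{f\in s^{-1}(v)}ff^*$ for each $v\in E^0$ with $0<|s^{-1}(v)|<\infty$. Modules $M$ over $L_K(E)$ are left and unital: $L_K(E)M=M$. Chen module: $e^\infty$ is the infinite path $eee\cdots$; an infinite path is tail equivalent to $e^\infty$ if it equals $\lambda e^\infty$ for some finite path $\lambda$; $[e^\infty]$ is the set of such infinite paths. $V_{[e^\infty]}$ is the vector space over the base field with basis $[e^\infty]$, with left action on $\mathfrak q=f_1f_2f_3\cdots\in[e^\infty]$: for a vertex $v$, $v\mathfrak q=\mathfrak q$ if $v=s(f_1)$ and $0$ otherwise; for an edge $f$, $f\mathfrak q=ff_1f_2\cdots$ if $r(f)=s(f_1)$ and $0$ otherwise; $f^*\mathfrak q=f_2f_3\cdots$ if $f=f_1$ and $0$ otherwise. Twisting: for $0\ne a$ in the base field, the gauge automorphism $\sigma_{e,a}$ is the algebra automorphism fixing all vertices, all edges $f\neq e_1$ and all $f^*\ne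 e_1^*$, and sending $e_1\mapsto ae_1$, $e_1^*\mapsto a^{-1}e_1^*$. For a left module $M$, $M^{\sigma_{e,a}}$ is $M$ as abelian group with action $\ell\star m=\sigma_{e,a}(\ell)m$. A polynomial $p(x)=p_nx^n+\cdots+p_1x-1\in K[x]$ is basic irreducible if it is irreducible in $K[x]$, has degree $\ge2$, and $p(0)=-1$. Then $\overline{x}\neq 0$ in $K'=K[x]/\langle p(x)\rangle$, and $V^p_{[e^\infty]}$ is the left $L_K(E)$-module obtained by restricting scalars from $K'$ to $K$ on the twisted left $L_{K'}(E)$-module $V^{\sigma_{e,\overline{x}}}_{[e^\infty]}$ (where $V_{[e^\infty]}$ is taken over $K'$). The evaluation is $p(e)=p_ne^n+\cdots+p_1e-s(e)\in L_K(E)$. *)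

(* Defs.v *)
From HB Require Import structures.
From mathcomp Require Import all_boot all_order all_algebra all_field.
From mathcomp Require Import finmap ring_quotient generic_quotient.
From mathcomp.classical Require Import boolp.
From mathcomp.multinomials Require Import monalg.

Set Implicit Arguments.
Unset Strict Implicit.
Unset Printing Implicit Defensive.

Import GRing.Theory.
Export Quotient.Exports.
Local Open Scope ring_scope.
Local Open Scope quotient_scope.

HB.mixin Record Zmodule_isRng R of GRing.Zmodule R := {
  rng_mul : R -> R -> R;
  rng_mulA : associative rng_mul;
  rng_mulDl : left_distributive rng_mul +%R;
  rng_mulDr : right_distributive rng_mul +%R
}.

#[short(type="rngType")]
HB.structure Definition Rng := {R of GRing.Zmodule R & Zmodule_isRng R}.

Notation "x ** y" := (rng_mul x y) (at level 40, left associativity) : ring_scope.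

Section RngTheory.
Variable R : rngType.
Implicit Types x y z : R.

Lemma rng_mul0r x : 0 ** x = 0.
Proof. by apply: (addrI (0 ** x)); rewrite -rng_mulDl !addr0. Qed.

Lemma rng_mulr0 x : x ** 0 = 0.
Proof. by apply: (addrI (x ** 0)); rewrite -rng_mulDr !addr0. Qed.

Lemma rng_mulNr x y : (- x) ** y = - (x ** y).
Proof. by apply: (addrI (x ** y)); rewrite -rng_mulDl !subrr rng_mul0r. Qed.

Lemma rng_mulrN x y : x ** (- y) = - (x ** y).
Proof. by apply: (addrI (x ** y)); rewrite -rng_mulDr !subrr rng_mulr0. Qed.

End RngTheory.

Record rng_hom (R S : rngType) := RngHom {
  rng_fun :> R -> S;
  rng_homD : {morph rng_fun : x y / x + y};
  rng_homM : {morph rng_fun : x y / x ** y}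
}.

Record lmodule (R : rngType) := LModule {
  lmod_sort :> zmodType;
  lact : R -> lmod_sort -> lmod_sort;
  lactDl : forall a b m, lact (a + b) m = lact a m + lact b m;
  lactDr : forall a m m', lact a (m + m') = lact a m + lact a m';
  lactA : forall a b m, lact (a ** b) m = lact a (lact b m)
}.
Arguments lact {R l} a m.

(* Restriction of scalars; for an endomorphism [phi] of [R] this is the twist
   [M^phi]: the abelian group [M] with action [a * m = phi(a) m]. *)
Section Restriction.
Variables (R S : rngType) (phi : rng_hom R S) (M : lmodule S).

Definition restrict_act (a : R) (m : M) : M := lact (phi a) m.

Fact restrict_actDl a b m :
  restrict_act (a + b) m = restrict_act a m + restrict_act b m.
Proof. by rewrite /restrict_act rng_homD lactDl. Qed.

Fact restrict_actDr a m m' :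
  restrict_act a (m + m') = restrict_act a m + restrict_act a m'.
Proof. exact: lactDr. Qed.

Fact restrict_actA a b m :
  restrict_act (a ** b) m = restrict_act a (restrict_act b m).
Proof. by rewrite /restrict_act rng_homM lactA. Qed.

Definition restrict : lmodule R :=
  LModule restrict_actDl restrict_actDr restrict_actA.

End Restriction.

Section LeftIdeal.
Variables (R : rngType) (a : R).

Definition left_mult : {pred R} := fun x => `[< exists r, x = r ** a >].

Fact left_mult_zmod_closed : zmod_closed left_mult.
Proof.
split; first by apply/asboolP; exists 0; rewrite rng_mul0r.
move=> x y /asboolP[r ->] /asboolP[s ->]; apply/asboolP; exists (r - s).
by rewrite rng_mulDl rng_mulNr.
Qed.

HB.instance Definition _ :=
  GRing.isZmodClosed.Build R left_mult left_mult_zmod_closed.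

Record left_ideal_type := LeftIdeal {
  left_val :> R;
  left_valP : left_val \in left_mult
}.

HB.instance Definition _ := [isSub for left_val].
HB.instance Definition _ := [Choice of left_ideal_type by <:].
HB.instance Definition _ := [SubChoice_isSubZmodule of left_ideal_type by <:].

Fact left_mult_act r x : x \in left_mult -> r ** x \in left_mult.
Proof. by move=> /asboolP[s ->]; apply/asboolP; exists (r ** s); rewrite rng_mulA. Qed.

Definition left_act (r : R) (x : left_ideal_type) : left_ideal_type :=
  LeftIdeal (left_mult_act r (left_valP x)).

Fact left_actDl r s x : left_act (r + s) x = left_act r x + left_act s x.
Proof. by apply: val_inj; rewrite /= rng_mulDl. Qed.

Fact left_actDr r x y : left_act r (x + y) = left_act r x + left_act r y.
Proof. by apply: val_inj; rewrite /= rng_mulDr. Qed.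

Fact left_actA r s x : left_act (r ** s) x = left_act r (left_act s x).
Proof. by apply: val_inj; rewrite /= rng_mulA. Qed.

Definition left_ideal : lmodule R :=
  @LModule R left_ideal_type left_act left_actDl left_actDr left_actA.

End LeftIdeal.

Section LeftIncl.
Variables (R : rngType) (a b : R).
Hypothesis ab : a \in left_mult b.

Fact left_incl_subproof (x : left_ideal a) : left_val x \in left_mult b.
Proof. by have /asboolP[r ->] := left_valP x; apply: left_mult_act. Qed.

Definition left_incl (x : left_ideal a) : left_ideal b :=
  LeftIdeal (left_incl_subproof x).

End LeftIncl.

Section ModuleNotions.
Variable R : rngType.
Implicit Types M N P : lmodule R.

Definition unital M : Prop :=
  forall m : M, exists s : seq (R * M), m = \sum_(x <- s) lact x.1 x.2.

Definition module_hom M N (f : M -> N) : Prop :=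
  {morph f : x y / x + y} /\ forall a, {morph f : x / lact a x}.

Definition submodule M (U : M -> Prop) : Prop :=
  [/\ U 0, forall x y, U x -> U y -> U (x - y) & forall a x, U x -> U (lact a x)].

Definition simple_module M : Prop :=
  [/\ unital M, exists m : M, m != 0 &
      forall U : M -> Prop, submodule U ->
        (forall m, U m -> m = 0) \/ (forall m, U m)].

(* [M = R m_1 + ... + R m_k]; when [R] has local units and [M] is unital this
   sum is the submodule generated by the [m_i]. *)
Definition finitely_generated M : Prop :=
  exists s : seq M, forall m : M,
    exists c : nat -> R, m = \sum_(i < size s) lact (c i) s`_i.

Definition projective P : Prop :=
  unital P /\
  forall M N (g : M -> N) (h : P -> N),
    unital M -> unital N -> module_hom g -> (forall y, exists x, g x = y) ->
    module_hom h ->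
    exists2 h' : P -> M, module_hom h' & forall x, g (h' x) = h x.

Definition short_exact M N P (f : M -> N) (g : N -> P) : Prop :=
  [/\ module_hom f, module_hom g, injective f,
      forall y, g y = 0 <-> exists x, f x = y &
      forall z, exists y, g y = z].

(* Nonzero free modules over a ring without unit need not be unital, so they
   are replaced by finitely generated projective unital modules. *)
Definition finitely_presented M : Prop :=
  unital M /\
  exists N P (f : N -> P) (g : P -> M),
    [/\ short_exact f g, projective P, finitely_generated P,
        unital N & finitely_generated N].

End ModuleNotions.

(* Locked: otherwise failed unifications unfold the sums, which is very slow. *)
HB.lock Definition lin_ext (R S : fieldType) (c : {rmorphism R -> S})
    (T : choiceType) (V : lmodType S) (f : T -> V) (g : {malg R[T]}) : V :=
  \sum_(k <- msupp g) c g@_k *: f k.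
Canonical lin_ext_unlockable := Unlockable lin_ext.unlock.

Section LinearExtension.
Variables (R S : fieldType) (c : {rmorphism R -> S}).
Variables (T : choiceType) (V : lmodType S) (f : T -> V).

Local Notation lin_ext := (lin_ext c f).

Lemma lin_extEw (d : {fset T}) (g : {malg R[T]}) : (msupp g `<=` d)%fset ->
  lin_ext g = \sum_(k <- d) c g@_k *: f k.
Proof.
move=> le_gd; rewrite unlock; apply: big_fset_incl => // k _ kg.
by rewrite mcoeff_outdom // rmorph0 scale0r.
Qed.

Lemma lin_extD : {morph lin_ext : x y / x + y}.
Proof.
move=> x y; pose d := (msupp x `|` msupp y)%fset.
rewrite !(@lin_extEw d) ?fsubsetUl ?fsubsetUr ?msuppD_le // -big_split /=.
by apply: eq_bigr => k _; rewrite mcoeffD rmorphD scalerDl.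
Qed.

Lemma lin_extZ a x : lin_ext (a *: x) = c a *: lin_ext x.
Proof.
rewrite !(@lin_extEw (msupp x)) ?msuppZ_le // scaler_sumr.
by apply: eq_bigr => k _; rewrite mcoeffZ rmorphM scalerA.
Qed.

Lemma lin_ext0 : lin_ext 0 = 0.
Proof. by rewrite unlock msupp0 big_seq_fset0. Qed.

Lemma lin_extU a k : lin_ext << a *g k >> = c a *: f k.
Proof.
by rewrite (@lin_extEw [fset k]%fset) ?msuppU_le // big_seq_fset1 mcoeffUU.
Qed.

Lemma lin_ext1 k : lin_ext << k >> = f k.
Proof. by rewrite lin_extU rmorph1 scale1r. Qed.

End LinearExtension.

Lemma malg_ind (K : fieldType) (T : choiceType) (P : {malg K[T]} -> Prop) :
  P 0 -> (forall x y, P x -> P y -> P (x + y)) ->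
  (forall a x, P x -> P (a *: x)) -> (forall k, P << k >>) ->
  forall x, P x.
Proof.
move=> P0 PD PZ PU x; rewrite [x]monalgE; apply: big_ind => // k _.
have -> : << x@_k *g k >> = x@_k *: << k >> :> {malg K[T]}.
  by apply/malgP => j; rewrite mcoeffZ !mcoeffU mulrnAr mulr1.
exact/PZ/PU.
Qed.

Record digraph := Digraph {
  vertex : Type;
  edge : Type;
  src : edge -> vertex;
  tgt : edge -> vertex
}.

HB.instance Definition _ (E : digraph) := gen_eqMixin (vertex E).
HB.instance Definition _ (E : digraph) := gen_choiceMixin (vertex E).
HB.instance Definition _ (E : digraph) := gen_eqMixin (edge E).
HB.instance Definition _ (E : digraph) := gen_choiceMixin (edge E).

Section Paths.
Variable E : digraph.

Fixpoint chain (v : vertex E) (l : seq (edge E)) : bool :=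
  if l is f :: l' then (src f == v) && chain (tgt f) l' else true.

Definition chain_end (v : vertex E) (l : seq (edge E)) : vertex E :=
  last v (map (@tgt E) l).

(* [(v, [:: f1; ...; fn])] is the path [f1 ... fn] with source [v]; [(v, [::])]
   is the vertex [v] as a path of length [0]. *)
Record gpath := GPath {
  gpath_val :> vertex E * seq (edge E);
  gpathP : chain gpath_val.1 gpath_val.2
}.

HB.instance Definition _ := [isSub for gpath_val].
HB.instance Definition _ := [Choice of gpath by <:].

Definition psrc (p : gpath) : vertex E := (gpath_val p).1.
Definition pedges (p : gpath) : seq (edge E) := (gpath_val p).2.
Definition ptgt (p : gpath) : vertex E := chain_end (psrc p) (pedges p).

Definition vpath (v : vertex E) : gpath := @GPath (v, [::]) isT.

Fact epath_subproof (f : edge E) : chain (src f) [:: f].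
Proof. by rewrite /= eqxx. Qed.

Definition epath (f : edge E) : gpath := @GPath (src f, [:: f]) (epath_subproof f).

Lemma chain_cat v l l' :
  chain v (l ++ l') = chain v l && chain (chain_end v l) l'.
Proof. by elim: l v => //= f l IHl v; rewrite IHl andbA. Qed.

Lemma chain_end_cat v l l' :
  chain_end v (l ++ l') = chain_end (chain_end v l) l'.
Proof. by rewrite /chain_end map_cat last_cat. Qed.

Fact pcat_subproof (p q : gpath) :
  ptgt p = psrc q -> chain (psrc p) (pedges p ++ pedges q).
Proof. by move=> pq; rewrite chain_cat gpathP -/(ptgt p) pq gpathP. Qed.

Definition pcat (p q : gpath) (pq : ptgt p = psrc q) : gpath :=
  @GPath (psrc p, pedges p ++ pedges q) (pcat_subproof pq).

End Paths.

Definition path_algebra (K : fieldType) (E : digraph) : Type := {malg K[gpath E]}.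

HB.instance Definition _ (K : fieldType) (E : digraph) :=
  GRing.Lmodule.on (path_algebra K E).

HB.lock Definition path_elt (K : fieldType) (E : digraph) (p : gpath E) :
  path_algebra K E := << p >>.

Section PathAlgebra.
Variables (K : fieldType) (E : digraph).
Local Notation A := (path_algebra K E).
Local Notation path_elt := (@path_elt K E).

Lemma lin_ext_path (S : fieldType) (c : {rmorphism K -> S}) (V : lmodType S)
  (f : gpath E -> V) p : lin_ext c f (path_elt p) = f p.
Proof. by rewrite path_elt.unlock lin_ext1. Qed.

Definition path_mul (p q : gpath E) : A :=
  if ptgt p =P psrc q is ReflectT pq then path_elt (pcat pq) else 0.

Definition pa_mul (x y : A) : A :=
  lin_ext idfun (fun p => lin_ext idfun (path_mul p) y) x.

Lemma pa_ind (P : A -> Prop) :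
  P 0 -> (forall x y, P x -> P y -> P (x + y)) ->
  (forall a x, P x -> P (a *: x)) -> (forall p, P (path_elt p)) ->
  forall x, P x.
Proof. by rewrite path_elt.unlock; exact: malg_ind. Qed.

Lemma pa_mulDl : left_distributive pa_mul +%R.
Proof. by move=> x y z; rewrite /pa_mul lin_extD. Qed.

Lemma pa_mulZl a x y : pa_mul (a *: x) y = a *: pa_mul x y.
Proof. by rewrite /pa_mul lin_extZ. Qed.

Lemma pa_mul0r y : pa_mul 0 y = 0. Proof. exact: lin_ext0. Qed.

Lemma pa_mulU p y : pa_mul (path_elt p) y = lin_ext idfun (path_mul p) y.
Proof. exact: lin_ext_path. Qed.

Lemma pa_mulDr : right_distributive pa_mul +%R.
Proof.
move=> x y z; elim/pa_ind: x => [|x x' IHx IHx'|a x IHx|p].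
- by rewrite (pa_mul0r y) (pa_mul0r z) (pa_mul0r (y + z)) addr0.
- by rewrite !pa_mulDl IHx IHx' addrACA.
- by rewrite !pa_mulZl IHx scalerDr.
- by rewrite !(pa_mulU p) lin_extD.
Qed.

Lemma pa_mulZr a x y : pa_mul x (a *: y) = a *: pa_mul x y.
Proof.
elim/pa_ind: x => [|x x' IHx IHx'|b x IHx|p].
- by rewrite (pa_mul0r y) (pa_mul0r (a *: y)) scaler0.
- by rewrite !pa_mulDl IHx IHx' scalerDr.
- by rewrite !pa_mulZl IHx !scalerA mulrC.
- by rewrite !(pa_mulU p) lin_extZ.
Qed.

Lemma pa_mulr0 x : pa_mul x 0 = 0.
Proof. by have := pa_mulZr 0 x 0; rewrite !scale0r. Qed.

Lemma pa_mul_path p q : pa_mul (path_elt p) (path_elt q) = path_mul p q.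
Proof. by rewrite pa_mulU; exact: lin_ext_path. Qed.

Lemma path_mulP p q (pq : ptgt p = psrc q) : path_mul p q = path_elt (pcat pq).
Proof.
rewrite /path_mul; case: eqP => // pq'; congr path_elt.
exact: val_inj.
Qed.

Lemma path_mul0 p q : ptgt p <> psrc q -> path_mul p q = 0.
Proof. by rewrite /path_mul; case: eqP. Qed.

Lemma pa_mulA : associative pa_mul.
Proof.
move=> x y z; elim/pa_ind: x => [|x x' IHx IHx'|a x IHx|p].
- by rewrite (pa_mul0r y) (pa_mul0r z) (pa_mul0r (pa_mul y z)).
- by rewrite !pa_mulDl IHx IHx'.
- by rewrite !pa_mulZl IHx.
elim/pa_ind: y => [|y y' IHy IHy'|a y IHy|q].
- by rewrite (pa_mul0r z) (pa_mulr0 (path_elt p)) (pa_mul0r z).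
- by rewrite !(pa_mulDl, pa_mulDr) IHy IHy'.
- rewrite (pa_mulZl a y z) (pa_mulZr a (path_elt p) (pa_mul y z)).
  by rewrite (pa_mulZr a (path_elt p) y) (pa_mulZl a _ z) IHy.
elim/pa_ind: z => [|z z' IHz IHz'|a z IHz|r].
- by rewrite (pa_mulr0 (path_elt q)) (pa_mulr0 (path_elt p)) pa_mulr0.
- by rewrite !pa_mulDr IHz IHz'.
- by rewrite !pa_mulZr IHz.
rewrite !pa_mul_path.
have [pq|npq] := ptgt p =P psrc q; have [qr|nqr] := ptgt q =P psrc r.
- rewrite (path_mulP pq) (path_mulP qr) !pa_mul_path.
  have pqr : ptgt (pcat pq) = psrc r.
    by rewrite /ptgt /= chain_end_cat -/(ptgt p) pq.
  have pqr' : ptgt p = psrc (pcat qr) by rewrite pq.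
  rewrite (path_mulP pqr) (path_mulP pqr'); congr path_elt.
  by apply: val_inj; rewrite /= catA.
- rewrite (path_mulP pq) (path_mul0 nqr) pa_mulr0 pa_mul_path path_mul0 //.
  by rewrite /ptgt /= chain_end_cat -/(ptgt p) pq.
- by rewrite (path_mul0 npq) (path_mulP qr) pa_mul0r pa_mul_path path_mul0.
- by rewrite !path_mul0 // pa_mulr0 pa_mul0r.
Qed.

HB.instance Definition _ :=
  Zmodule_isRng.Build A pa_mulA pa_mulDl pa_mulDr.

End PathAlgebra.

(* The double graph: [inl f] is the edge [f] and [inr f] the ghost edge [f^*]. *)
Definition double (E : digraph) : digraph :=
  @Digraph (vertex E) (edge E + edge E)
    (fun g => match g with inl f => src f | inr f => tgt f end)
    (fun g => match g with inl f => tgt f | inr f => src f end).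

Section LeavittIdeal.
Variables (K : fieldType) (E : digraph).
Local Notation A := (path_algebra K (double E)).

Definition pa_vertex (v : vertex E) : A := path_elt K (@vpath (double E) v).
Definition pa_edge (f : edge E) : A := path_elt K (@epath (double E) (inl f)).
Definition pa_ghost (f : edge E) : A := path_elt K (@epath (double E) (inr f)).

(* In [ideal_CK2], a list [fs] as required exists exactly when
   [0 < |s^{-1}(v)| < oo]. *)
Inductive leavitt_ideal : A -> Prop :=
| ideal_CK1 f g : leavitt_ideal
    (pa_ghost f ** pa_edge g - (if f == g then pa_vertex (tgt f) else 0))
| ideal_CK2 v (fs : seq (edge E)) :
    uniq fs -> (0 < size fs)%N -> (forall f, (f \in fs) = (src f == v)) ->
    leavitt_ideal (pa_vertex v - \sum_(f <- fs) pa_edge f ** pa_ghost f)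
| ideal_0 : leavitt_ideal 0
| ideal_D x y : leavitt_ideal x -> leavitt_ideal y -> leavitt_ideal (x + y)
| ideal_Z a x : leavitt_ideal x -> leavitt_ideal (a *: x)
| ideal_Ml x y : leavitt_ideal y -> leavitt_ideal (x ** y)
| ideal_Mr x y : leavitt_ideal x -> leavitt_ideal (x ** y).

Definition leavitt_idealb : {pred A} := fun x => `[< leavitt_ideal x >].

Fact leavitt_idealB x y :
  leavitt_ideal x -> leavitt_ideal y -> leavitt_ideal (x - y).
Proof.
by move=> Ix Iy; apply: ideal_D => //; rewrite -scaleN1r; apply: ideal_Z.
Qed.

Fact leavitt_ideal_zmod_closed : zmod_closed leavitt_idealb.
Proof.
split; first by apply/asboolP; exact: ideal_0.
by move=> x y /asboolP Ix /asboolP Iy; apply/asboolP; exact: leavitt_idealB.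
Qed.

HB.instance Definition _ :=
  GRing.isZmodClosed.Build A leavitt_idealb leavitt_ideal_zmod_closed.

End LeavittIdeal.

Definition leavitt (K : fieldType) (E : digraph) : Type :=
  Quotient.quot (@leavitt_idealb K E).

HB.instance Definition _ (K : fieldType) (E : digraph) :=
  GRing.Zmodule.on (leavitt K E).

HB.lock Definition leavitt_pi (K : fieldType) (E : digraph)
  (x : path_algebra K (double E)) : leavitt K E :=
  \pi_(Quotient.quot (@leavitt_idealb K E)) x.

HB.lock Definition leavitt_repr (K : fieldType) (E : digraph)
  (x : leavitt K E) : path_algebra K (double E) :=
  repr (x : Quotient.quot (@leavitt_idealb K E)).

Section LeavittAlgebra.
Variables (K : fieldType) (E : digraph).
Local Notation A := (path_algebra K (double E)).
Local Notation L := (leavitt K E).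
Local Notation pi := (@leavitt_pi K E).
Local Notation rep := (@leavitt_repr K E).

Lemma leavitt_reprK : cancel rep pi.
Proof. by move=> x; rewrite leavitt_pi.unlock leavitt_repr.unlock; exact: reprK. Qed.

Lemma leavitt_piP (x y : A) : pi x = pi y <-> leavitt_ideal (x - y).
Proof.
rewrite leavitt_pi.unlock; split=> [/eqP|Ixy].
  by rewrite -Quotient.idealrBE => /asboolP.
by apply/eqP; rewrite -Quotient.idealrBE; apply/asboolP.
Qed.

Lemma leavitt_piD : {morph pi : x y / x + y}.
Proof. by move=> x y; rewrite leavitt_pi.unlock; exact: raddfD. Qed.

Lemma leavitt_pi0 : pi 0 = 0.
Proof. by rewrite leavitt_pi.unlock; exact: raddf0. Qed.

Lemma leavitt_reprP (x : A) : leavitt_ideal (rep (pi x) - x).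
Proof. by apply/leavitt_piP; rewrite leavitt_reprK. Qed.

Definition leavitt_mul (x y : L) : L := pi (rep x ** rep y).
Definition leavitt_scale (a : K) (x : L) : L := pi (a *: rep x).

Lemma leavitt_piM (x y : A) : pi (x ** y) = leavitt_mul (pi x) (pi y).
Proof.
apply/esym/leavitt_piP.
have -> : rep (pi x) ** rep (pi y) - x ** y =
    (rep (pi x) - x) ** rep (pi y) + x ** (rep (pi y) - y).
  by rewrite rng_mulDl rng_mulDr rng_mulNr rng_mulrN addrA subrK.
by apply: ideal_D; [apply: ideal_Mr|apply: ideal_Ml]; exact: leavitt_reprP.
Qed.

Lemma leavitt_piZ a (x : A) : pi (a *: x) = leavitt_scale a (pi x).
Proof.
by apply/esym/leavitt_piP; rewrite -scalerBr; apply: ideal_Z; exact: leavitt_reprP.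
Qed.

Lemma leavitt_mulA : associative leavitt_mul.
Proof.
move=> x y z; rewrite -[x]leavitt_reprK -[y]leavitt_reprK -[z]leavitt_reprK.
by rewrite -!leavitt_piM rng_mulA.
Qed.

Lemma leavitt_mulDl : left_distributive leavitt_mul +%R.
Proof.
move=> x y z; rewrite -[x]leavitt_reprK -[y]leavitt_reprK -[z]leavitt_reprK.
by rewrite -leavitt_piD -!leavitt_piM -leavitt_piD rng_mulDl.
Qed.

Lemma leavitt_mulDr : right_distributive leavitt_mul +%R.
Proof.
move=> x y z; rewrite -[x]leavitt_reprK -[y]leavitt_reprK -[z]leavitt_reprK.
by rewrite -leavitt_piD -!leavitt_piM -leavitt_piD rng_mulDr.
Qed.

HB.instance Definition _ :=
  Zmodule_isRng.Build L leavitt_mulA leavitt_mulDl leavitt_mulDr.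

Lemma leavitt_scaleA a b x :
  leavitt_scale a (leavitt_scale b x) = leavitt_scale (a * b) x.
Proof. by rewrite -[x]leavitt_reprK -!leavitt_piZ scalerA. Qed.

Lemma leavitt_scale1 : left_id 1 leavitt_scale.
Proof. by move=> x; rewrite -[x]leavitt_reprK -leavitt_piZ scale1r. Qed.

Lemma leavitt_scaleDr : right_distributive leavitt_scale +%R.
Proof.
move=> a x y; rewrite -[x]leavitt_reprK -[y]leavitt_reprK.
by rewrite -leavitt_piD -!leavitt_piZ -leavitt_piD scalerDr.
Qed.

Lemma leavitt_scaleDl x : {morph leavitt_scale^~ x : a b / a + b}.
Proof.
move=> a b; rewrite -[x]leavitt_reprK.
by rewrite -!leavitt_piZ -leavitt_piD scalerDl.
Qed.

HB.instance Definition _ := GRing.Zmodule_isLmodule.Build K L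
  leavitt_scaleA leavitt_scale1 leavitt_scaleDr leavitt_scaleDl.

Definition lvertex (v : vertex E) : L := pi (pa_vertex K v).
Definition ledge (f : edge E) : L := pi (pa_edge K f).
Definition lghost (f : edge E) : L := pi (pa_ghost K f).

Fact real_path_subproof (p : gpath E) :
  @chain (double E) (psrc p) (map inl (pedges p)).
Proof.
have := gpathP p; rewrite -/(psrc p) -/(pedges p).
by elim: (pedges p) (psrc p) => //= f l IHl v /andP[-> /IHl].
Qed.

Definition real_path (p : gpath E) : gpath (double E) :=
  @GPath (double E) (psrc p, map inl (pedges p)) (real_path_subproof p).

Definition lpath (p : gpath E) : L := pi (path_elt K (real_path p)).

End LeavittAlgebra.

Section LeavittTheory.
Variables (K : fieldType) (E : digraph).

Lemma path_algebra_mulZl a (x y : path_algebra K E) : (a *: x) ** y = a *: (x ** y).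
Proof. exact: pa_mulZl. Qed.

Lemma path_algebra_mulZr a (x y : path_algebra K E) : x ** (a *: y) = a *: (x ** y).
Proof. exact: pa_mulZr. Qed.

Local Notation pi := (@leavitt_pi K E).

Lemma leavitt_pi_mul x y : pi (x ** y) = pi x ** pi y.
Proof. exact: leavitt_piM. Qed.

Lemma leavitt_pi_scale a x : pi (a *: x) = a *: pi x.
Proof. exact: leavitt_piZ. Qed.

Lemma leavitt_piN x : pi (- x) = - pi x.
Proof. by rewrite -scaleN1r leavitt_pi_scale scaleN1r. Qed.

Lemma leavitt_pi_sum I (r : seq I) (F : I -> path_algebra K (double E)) :
  pi (\sum_(i <- r) F i) = \sum_(i <- r) pi (F i).
Proof. exact: (big_morph _ (@leavitt_piD K E) (@leavitt_pi0 K E)). Qed.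

Lemma leavitt_pi_ideal x : leavitt_ideal x -> pi x = 0.
Proof. by move=> Ix; rewrite -leavitt_pi0; apply/leavitt_piP; rewrite subr0. Qed.

Lemma leavitt_CK1 (f g : edge E) :
  lghost K f ** ledge K g = if f == g then lvertex K (tgt f) else 0.
Proof.
have /leavitt_pi_ideal := ideal_CK1 K f g.
rewrite leavitt_piD leavitt_piN leavitt_pi_mul => /eqP.
by rewrite subr_eq0 => /eqP ->; case: eqP => // _; exact: leavitt_pi0.
Qed.

Lemma leavitt_CK2 (v : vertex E) (fs : seq (edge E)) :
  uniq fs -> (0 < size fs)%N -> (forall f, (f \in fs) = (src f == v)) ->
  lvertex K v = \sum_(f <- fs) ledge K f ** lghost K f.
Proof.
move=> Ufs fs0 fsE; have /leavitt_pi_ideal := ideal_CK2 K Ufs fs0 fsE.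
rewrite leavitt_piD leavitt_piN leavitt_pi_sum => /eqP.
rewrite subr_eq0 => /eqP vE; rewrite /lvertex vE.
by apply: eq_bigr => f _; rewrite leavitt_pi_mul.
Qed.

End LeavittTheory.

(* The map which applies [c] to coefficients and multiplies each path
   [g_1 ... g_n] by [w(g_1) ... w(g_n)]; base change is the case [w = 1], gauge
   automorphisms are the case [c = id]. *)
Section WeightMap.
Variables (K S : fieldType) (c : {rmorphism K -> S}) (E : digraph).
Variable w : edge E -> S.
Hypothesis w_neq0 : forall f, w f != 0.

Local Notation A := (path_algebra K (double E)).
Local Notation B := (path_algebra S (double E)).

Definition double_weight (g : edge (double E)) : S :=
  match g with inl f => w f | inr f => (w f)^-1 end.

Definition pa_wmap (x : A) : B :=
  lin_ext c (fun p => (\prod_(g <- pedges p) double_weight g) *: path_elt S p) x.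

Lemma pa_wmapD : {morph pa_wmap : x y / x + y}.
Proof. exact: lin_extD. Qed.

Lemma pa_wmapZ a x : pa_wmap (a *: x) = c a *: pa_wmap x.
Proof. exact: lin_extZ. Qed.

Lemma pa_wmap0 : pa_wmap 0 = 0.
Proof. exact: lin_ext0. Qed.

Lemma pa_wmapB x y : pa_wmap (x - y) = pa_wmap x - pa_wmap y.
Proof. by rewrite pa_wmapD -scaleN1r pa_wmapZ rmorphN1 scaleN1r. Qed.

Lemma pa_wmap_path p :
  pa_wmap (path_elt K p) = (\prod_(g <- pedges p) double_weight g) *: path_elt S p.
Proof. exact: lin_ext_path. Qed.

Lemma pa_wmapM x y : pa_wmap (x ** y) = pa_wmap x ** pa_wmap y.
Proof.
elim/pa_ind: x => [|x x' IHx IHx'|a x IHx|p].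
- by rewrite rng_mul0r pa_wmap0 rng_mul0r.
- by rewrite rng_mulDl !pa_wmapD IHx IHx' rng_mulDl.
- by rewrite path_algebra_mulZl !pa_wmapZ IHx path_algebra_mulZl.
elim/pa_ind: y => [|y y' IHy IHy'|a y IHy|q].
- by rewrite rng_mulr0 pa_wmap0 rng_mulr0.
- by rewrite rng_mulDr !pa_wmapD IHy IHy' rng_mulDr.
- by rewrite path_algebra_mulZr !pa_wmapZ IHy path_algebra_mulZr.
rewrite !pa_wmap_path path_algebra_mulZl path_algebra_mulZr scalerA.
rewrite [LHS](congr1 _ (pa_mul_path K p q)).
rewrite [X in _ = _ *: X](pa_mul_path S p q).
have [pq|npq] := ptgt p =P psrc q; last by rewrite !path_mul0 // pa_wmap0 scaler0.
by rewrite !(path_mulP _ pq) pa_wmap_path big_cat.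
Qed.

Lemma double_weightV f : double_weight (inr f) * double_weight (inl f) = 1.
Proof. exact: mulVf. Qed.

Lemma pa_wmap_vertex v : pa_wmap (pa_vertex K v) = pa_vertex S v.
Proof. by rewrite pa_wmap_path big_nil scale1r. Qed.

Lemma pa_wmap_edge f : pa_wmap (pa_edge K f) = w f *: pa_edge S f.
Proof. by rewrite pa_wmap_path big_seq1. Qed.

Lemma pa_wmap_ghost f : pa_wmap (pa_ghost K f) = (w f)^-1 *: pa_ghost S f.
Proof. by rewrite pa_wmap_path big_seq1. Qed.

Lemma pa_wmap_ideal x : leavitt_ideal x -> leavitt_ideal (pa_wmap x).
Proof.
elim=> {x} [f g|v fs Ufs fs0 fsE||x y _ Ix _ Iy|a x _ Ix|x y _ Iy|x y _ Ix].
- rewrite pa_wmapB pa_wmapM pa_wmap_ghost pa_wmap_edge.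
  rewrite path_algebra_mulZl path_algebra_mulZr scalerA.
  have := ideal_CK1 S f g; case: eqP => [<-|_] I1.
    by rewrite mulVf // scale1r pa_wmap_vertex.
  by rewrite pa_wmap0 subr0; apply: ideal_Z; rewrite subr0 in I1.
- have -> : pa_wmap (pa_vertex K v - \sum_(f <- fs) pa_edge K f ** pa_ghost K f) =
    pa_vertex S v - \sum_(f <- fs) pa_edge S f ** pa_ghost S f.
    rewrite pa_wmapB pa_wmap_vertex (big_morph _ pa_wmapD pa_wmap0); congr (_ - _).
    apply: eq_bigr => f _; rewrite pa_wmapM pa_wmap_ghost pa_wmap_edge.
    by rewrite path_algebra_mulZl path_algebra_mulZr scalerA mulfV // scale1r.
  exact: ideal_CK2.
- by rewrite pa_wmap0; exact: ideal_0.
- by rewrite pa_wmapD; exact: ideal_D.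
- by rewrite pa_wmapZ; exact: ideal_Z.
- by rewrite pa_wmapM; exact: ideal_Ml.
- by rewrite pa_wmapM; exact: ideal_Mr.
Qed.

Definition leavitt_wmap (x : leavitt K E) : leavitt S E :=
  leavitt_pi (pa_wmap (leavitt_repr x)).

Lemma leavitt_wmap_pi x : leavitt_wmap (leavitt_pi x) = leavitt_pi (pa_wmap x).
Proof.
by apply/leavitt_piP; rewrite -pa_wmapB; apply: pa_wmap_ideal; exact: leavitt_reprP.
Qed.

Fact leavitt_wmapD : {morph leavitt_wmap : x y / x + y}.
Proof.
move=> x y; rewrite -[x]leavitt_reprK -[y]leavitt_reprK -leavitt_piD.
by rewrite !leavitt_wmap_pi pa_wmapD leavitt_piD.
Qed.

Fact leavitt_wmapM : {morph leavitt_wmap : x y / x ** y}.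
Proof.
move=> x y; rewrite -[x]leavitt_reprK -[y]leavitt_reprK -leavitt_pi_mul.
by rewrite !leavitt_wmap_pi pa_wmapM leavitt_pi_mul.
Qed.

Definition weight_hom : rng_hom (leavitt K E) (leavitt S E) :=
  RngHom leavitt_wmapD leavitt_wmapM.

Lemma weight_homZ a x : weight_hom (a *: x) = c a *: weight_hom x.
Proof.
rewrite /= -[x]leavitt_reprK -leavitt_pi_scale.
by rewrite !leavitt_wmap_pi pa_wmapZ leavitt_pi_scale.
Qed.

Lemma weight_hom_vertex v : weight_hom (lvertex K v) = lvertex S v.
Proof. by rewrite /= leavitt_wmap_pi pa_wmap_vertex. Qed.

Lemma weight_hom_edge f : weight_hom (ledge K f) = w f *: ledge S f.
Proof. by rewrite /= leavitt_wmap_pi pa_wmap_edge leavitt_pi_scale. Qed.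

Lemma weight_hom_ghost f : weight_hom (lghost K f) = (w f)^-1 *: lghost S f.
Proof. by rewrite /= leavitt_wmap_pi pa_wmap_ghost leavitt_pi_scale. Qed.

End WeightMap.

Definition base_change (K S : fieldType) (c : {rmorphism K -> S}) (E : digraph) :
  rng_hom (leavitt K E) (leavitt S E) :=
  @weight_hom K S c E (fun=> 1) (fun=> oner_neq0 S).

Lemma base_change_path (K S : fieldType) (c : {rmorphism K -> S}) (E : digraph)
  (p : gpath (double E)) :
  base_change c E (leavitt_pi (path_elt K p)) = leavitt_pi (path_elt S p).
Proof.
rewrite /= leavitt_wmap_pi ?pa_wmap_path; last by move=> _; exact: oner_neq0.
by rewrite big1 ?scale1r // => -[] f _ //=; rewrite invr1.
Qed.

(* A cycle [e_1 ... e_N]: [cycle_head] is [e_1], so that [N >= 1]. *)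
Record graph_cycle (E : digraph) := GraphCycle {
  cycle_head : edge E;
  cycle_tail : seq (edge E);
  cycle_chain : chain (src cycle_head) (cycle_head :: cycle_tail);
  cycle_closed :
    chain_end (src cycle_head) (cycle_head :: cycle_tail) = src cycle_head;
  cycle_uniq : uniq (map (@src E) (cycle_head :: cycle_tail))
}.

Section Gauge.
Variables (K : fieldType) (E : digraph) (e : graph_cycle E).

Definition cycle_src : vertex E := src (cycle_head e).

Definition cycle_edges : seq (edge E) := cycle_head e :: cycle_tail e.

Definition cycle_path : gpath E :=
  @GPath E (cycle_src, cycle_edges) (cycle_chain e).

Definition gauge_weight (a : K) (f : edge E) : K :=
  if f == cycle_head e then a else 1.

Fact gauge_weight_neq0 a : a != 0 -> forall f, gauge_weight a f != 0.
Proof. by move=> a0 f; rewrite /gauge_weight; case: ifP => // _; exact: oner_neq0. Qed.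

Variables (a : K) (a_neq0 : a != 0).

Definition gauge : rng_hom (leavitt K E) (leavitt K E) :=
  weight_hom idfun (gauge_weight_neq0 a_neq0).

Lemma gaugeZ b x : gauge (b *: x) = b *: gauge x.
Proof. exact: weight_homZ. Qed.

Lemma gauge_vertex v : gauge (lvertex K v) = lvertex K v.
Proof. exact: weight_hom_vertex. Qed.

Lemma gauge_edge f :
  gauge (ledge K f) = if f == cycle_head e then a *: ledge K f else ledge K f.
Proof.
by rewrite [LHS]weight_hom_edge /gauge_weight; case: ifP; rewrite ?scale1r.
Qed.

Lemma gauge_ghost f :
  gauge (lghost K f) = if f == cycle_head e then a^-1 *: lghost K f else lghost K f.
Proof.
by rewrite [LHS]weight_hom_ghost /gauge_weight; case: ifP; rewrite ?invr1 ?scale1r.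
Qed.

End Gauge.

Lemma gaugeK (K : fieldType) (E : digraph) (e : graph_cycle E) (a : K)
  (a0 : a != 0) (aV0 : a^-1 != 0) : cancel (gauge e a0) (gauge e aV0).
Proof.
move=> x; rewrite -[x]leavitt_reprK; move: (leavitt_repr x) => {}x.
rewrite /= leavitt_wmap_pi ?leavitt_wmap_pi; try exact: gauge_weight_neq0.
congr leavitt_pi; elim/pa_ind: x => [|x y IHx IHy|b x IHx|p].
- by rewrite !pa_wmap0.
- by rewrite !pa_wmapD IHx IHy.
- by rewrite !pa_wmapZ IHx.
rewrite pa_wmap_path pa_wmapZ pa_wmap_path scalerA -big_split big1 ?scale1r //.
by move=> [] f _ /=; rewrite /gauge_weight; case: ifP; rewrite ?invrK ?invr1 ?mulr1 ?mulVf ?mulfV.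
Qed.

Section ChenBasis.
Variables (E : digraph) (e : graph_cycle E).

Definition infinite_path (q : nat -> edge E) : Prop :=
  forall i, tgt (q i) = src (q i.+1).

Definition icat (l : seq (edge E)) (q : nat -> edge E) : nat -> edge E :=
  fun i => if (i < size l)%N then nth (q 0) l i else q (i - size l)%N.

Definition cycle_inf : nat -> edge E :=
  fun i => nth (cycle_head e) (cycle_edges e) (i %% size (cycle_edges e)).

Definition tail_equiv (q : nat -> edge E) : bool :=
  `[< infinite_path q /\
      exists p : gpath E, ptgt p = cycle_src e /\ q = icat (pedges p) cycle_inf >].

Record chen_basis := ChenBasis {
  chen_val :> nat -> edge E;
  chen_valP : tail_equiv chen_val
}.

HB.instance Definition _ := [isSub for chen_val].
HB.instance Definition _ := [Choice of chen_basis by <:].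

Definition chen_src (q : chen_basis) : vertex E := src (q 0).

Lemma nth_chain (x : edge E) v l i : chain v l -> (i.+1 < size l)%N ->
  tgt (nth x l i) = src (nth x l i.+1).
Proof.
elim: l v i => // f l IHl v i /= /andP[_ fl] il.
case: i il => [|i] il; last exact: IHl fl _.
by case: l {IHl} fl il => //= g l /andP[/eqP].
Qed.

Fact cycle_inf_path : infinite_path cycle_inf.
Proof.
move=> i; rewrite /cycle_inf; set N := size _; set l := cycle_edges e.
have N0 : (0 < N)%N by [].
have lti : (i %% N < N)%N by rewrite ltn_mod.
have -> : (i.+1 %% N = if (i %% N).+1 == N then 0 else (i %% N).+1)%N.
  rewrite -addn1 -modnDml addn1; case: eqP => [->|/eqP Ni]; first exact: modnn.
  by rewrite modn_small // ltn_neqAle Ni.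
case: eqP => [iN|/eqP Ni].
  rewrite (congr1 predn iN : (i %% N)%N = N.-1).
  transitivity (src (cycle_head e)) => //.
  rewrite -[RHS](cycle_closed e) /chain_end -/l (last_nth (src (cycle_head e))).
  rewrite size_map; apply/esym.
  exact: (@nth_map _ (cycle_head e) _ _ (@tgt E) N.-1 l).
by apply: nth_chain (cycle_chain e) _; rewrite ltn_neqAle Ni.
Qed.

Fact chen_cons_subproof (f : edge E) (q : chen_basis) :
  tgt f = chen_src q -> tail_equiv (icat [:: f] q).
Proof.
move=> fq; have /asboolP[iq [p [pe qE]]] := chen_valP q.
apply/asboolP; split; first by case=> [|i]; rewrite /icat //= subn1.
have sp : psrc p = chen_src q.
  have := gpathP p; rewrite /chen_src qE -/(psrc p) -/(pedges p).
  move: pe; rewrite /ptgt /icat; case: (pedges p) => [|g l] /= pe.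
    by rewrite /chain_end /= in pe.
  by case/andP=> /eqP.
have fp : chain (src f) (f :: pedges p).
  by rewrite /= eqxx fq -sp; exact: gpathP.
exists (@GPath E (src f, f :: pedges p) fp); split.
  by rewrite -pe /ptgt /chain_end /= fq -sp.
by rewrite qE; apply/funext => -[|i]; rewrite /icat //= ltnS subn1 subSS.
Qed.

Definition chen_cons (f : edge E) (q : chen_basis) (fq : tgt f = chen_src q) :
  chen_basis := ChenBasis (chen_cons_subproof fq).

Fact chen_tail_subproof (q : chen_basis) : tail_equiv (fun i => q i.+1).
Proof.
have /asboolP[iq [p [pe qE]]] := chen_valP q.
apply/asboolP; split; first by move=> i; exact: iq.
have tailP v f l : chain v (f :: l) -> chain_end v (f :: l) = cycle_src e ->
    exists p' : gpath E, ptgt p' = cycle_src e /\ pedges p' = l.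
  by move=> /andP[_ cl] le; exists (@GPath E (tgt f, l) cl).
case El : (pedges p) => [|f l].
  have [p' [p'e p'l]] := tailP _ _ _ (cycle_chain e) (cycle_closed e).
  exists p'; split=> //; rewrite qE El p'l; apply/funext => i.
  rewrite /icat /= subn0 /cycle_inf /cycle_edges /=.
  set N := size (cycle_tail e).
  have [iN|Ni] := ltnP i N; first by rewrite modn_small //=; exact: set_nth_default.
  by rewrite -{1}(subnK Ni) -addnS modnDr.
have [||p' [p'e p'l]] := tailP (psrc p) f l.
- by rewrite -El; exact: gpathP.
- by rewrite -El.
exists p'; split=> //; rewrite qE El p'l; apply/funext => i.
by rewrite /icat /= ltnS subSS.
Qed.

Definition chen_tail (q : chen_basis) : chen_basis :=
  ChenBasis (chen_tail_subproof q).

Fact cycle_inf_subproof : tail_equiv cycle_inf.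
Proof.
apply/asboolP; split; first exact: cycle_inf_path.
exists (vpath (cycle_src e)); split=> //.
by apply/funext => i; rewrite /icat /= subn0.
Qed.

Definition chen_inf : chen_basis := ChenBasis cycle_inf_subproof.

End ChenBasis.

Section ChenModule.
Variables (K : fieldType) (E : digraph) (e : graph_cycle E).
Local Notation V := {malg K[chen_basis e]}.
Local Notation A := (path_algebra K (double E)).
Local Notation L := (leavitt K E).

Definition chen_vertex (v : vertex E) (q : chen_basis e) : V :=
  if v == chen_src q then << q >> else 0.

Definition chen_edge (g : edge (double E)) (q : chen_basis e) : V :=
  match g with
  | inl f => if tgt f =P chen_src q is ReflectT fq then << chen_cons fq >> else 0
  | inr f => if f == chen_val q 0 then << chen_tail q >> else 0
  end.

Definition chen_path (p : gpath (double E)) (m : V) : V :=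
  lin_ext idfun (chen_vertex (psrc p))
    (foldr (fun g => lin_ext idfun (chen_edge g)) m (pedges p)).

Definition chen_pa_act (x : A) (m : V) : V :=
  lin_ext idfun (fun p => chen_path p m) x.

Definition chen_act (x : L) (m : V) : V := chen_pa_act (leavitt_repr x) m.

Local Notation vact v := (lin_ext idfun (chen_vertex v)).
Local Notation gact g := (lin_ext idfun (chen_edge g)).

Lemma chen_vact_vact v w m : vact v (vact w m) = if v == w then vact w m else 0.
Proof.
elim/malg_ind: m => [|x y IHx IHy|a x IHx|q].
- by rewrite !lin_ext0 if_same.
- by rewrite !lin_extD IHx IHy; case: eqP; rewrite ?addr0.
- by rewrite !lin_extZ IHx; case: eqP; rewrite ?scaler0.
rewrite !lin_ext1 /chen_vertex; case: (w =P chen_src q) => [->|wq].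
  by rewrite lin_ext1 /chen_vertex.
by rewrite lin_ext0 if_same.
Qed.

Lemma chen_vact_gact (g : edge (double E)) m : vact (src g) (gact g m) = gact g m.
Proof.
elim/malg_ind: m => [|x y IHx IHy|a x IHx|q].
- by rewrite !lin_ext0.
- by rewrite !lin_extD IHx IHy.
- by rewrite !lin_extZ IHx.
rewrite !lin_ext1; case: g => f /=.
  by case: eqP => [fq|_]; rewrite ?lin_ext0 // lin_ext1 /chen_vertex eqxx.
case: eqP => [fq|_]; rewrite ?lin_ext0 // lin_ext1 /chen_vertex fq.
have /asboolP[iq _] := chen_valP q.
by rewrite [chen_src _]/chen_src /= -iq eqxx.
Qed.

Lemma chen_gact_vact (g : edge (double E)) w m :
  gact g (vact w m) = if tgt g == w then gact g m else 0.
Proof.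
elim/malg_ind: m => [|x y IHx IHy|a x IHx|q].
- by rewrite !lin_ext0 if_same.
- by rewrite !lin_extD IHx IHy; case: eqP; rewrite ?addr0.
- by rewrite !lin_extZ IHx; case: eqP; rewrite ?scaler0.
rewrite !lin_ext1 /chen_vertex; case: (w =P chen_src q) => [->|wq].
  rewrite lin_ext1; case: eqP => // gq; case: g gq => f /= gq.
    by case: eqP.
  by case: eqP => // fq; case: gq; rewrite fq.
rewrite lin_ext0; case: eqP => // gw; case: g gw => f /= gw.
  by case: eqP => // fq; case: wq; rewrite -gw.
by case: eqP => // fq; case: wq; rewrite -gw fq.
Qed.

Lemma chen_path0 p : chen_path p 0 = 0.
Proof.
rewrite /chen_path; elim: (pedges p) (psrc p) => [|g l IHl] v /=.
  by rewrite lin_ext0.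
have -> : foldr (fun g => gact g) 0 l = 0.
  by elim: (l) => //= h k ->; rewrite lin_ext0.
by rewrite !lin_ext0.
Qed.

Lemma chen_pathD p : {morph chen_path p : x y / x + y}.
Proof.
move=> x y; rewrite /chen_path -lin_extD; congr (lin_ext _ _ _).
by elim: (pedges p) => //= g l ->; rewrite lin_extD.
Qed.

Lemma chen_pathZ p a x : chen_path p (a *: x) = a *: chen_path p x.
Proof.
rewrite /chen_path -[in RHS](lin_extZ idfun); congr (lin_ext _ _ _).
by elim: (pedges p) => //= g l ->; rewrite lin_extZ.
Qed.

Lemma chen_path_vact p w m :
  chen_path p (vact w m) = if ptgt p == w then chen_path p m else 0.
Proof.
have := gpathP p; rewrite /chen_path /ptgt -/(psrc p) -/(pedges p).
elim: (pedges p) (psrc p) => [|g l IHl] v /=.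
  by move=> _; rewrite chen_vact_vact; case: eqP => // ->.
case/andP=> _ /IHl{}IHl.
have gE x : gact g x = gact g (vact (tgt g) x) by rewrite chen_gact_vact eqxx.
rewrite gE IHl -/(chain_end (tgt g) l) [in RHS]gE.
by case: eqP => _ //; rewrite !lin_ext0.
Qed.

Lemma chen_path_cat p q m (pq : ptgt p = psrc q) :
  chen_path (pcat pq) m = chen_path p (chen_path q m).
Proof.
by rewrite [chen_path q m]/chen_path chen_path_vact pq eqxx /chen_path /= foldr_cat.
Qed.

Lemma chen_pa_actDl x y m : chen_pa_act (x + y) m = chen_pa_act x m + chen_pa_act y m.
Proof. exact: lin_extD. Qed.

Lemma chen_pa_actZl a x m : chen_pa_act (a *: x) m = a *: chen_pa_act x m.
Proof. exact: lin_extZ. Qed.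

Lemma chen_pa_act0 m : chen_pa_act 0 m = 0.
Proof. exact: lin_ext0. Qed.

Lemma chen_pa_act_path p m : chen_pa_act (path_elt K p) m = chen_path p m.
Proof. exact: lin_ext_path. Qed.

Lemma chen_pa_actDr x m m' : chen_pa_act x (m + m') = chen_pa_act x m + chen_pa_act x m'.
Proof.
elim/pa_ind: x => [|x x' IHx IHx'|a x IHx|p].
- by rewrite !chen_pa_act0 addr0.
- by rewrite !chen_pa_actDl IHx IHx' addrACA.
- by rewrite !chen_pa_actZl IHx scalerDr.
- by rewrite !chen_pa_act_path chen_pathD.
Qed.

Lemma chen_pa_actZr x a m : chen_pa_act x (a *: m) = a *: chen_pa_act x m.
Proof.
elim/pa_ind: x => [|x x' IHx IHx'|b x IHx|p].
- by rewrite !chen_pa_act0 scaler0.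
- by rewrite !chen_pa_actDl IHx IHx' scalerDr.
- by rewrite !chen_pa_actZl IHx !scalerA mulrC.
- by rewrite !chen_pa_act_path chen_pathZ.
Qed.

Lemma chen_pa_act0r x : chen_pa_act x 0 = 0.
Proof. by have := chen_pa_actZr x 0 0; rewrite !scale0r. Qed.

Lemma chen_pa_actA x y m : chen_pa_act (x ** y) m = chen_pa_act x (chen_pa_act y m).
Proof.
elim/pa_ind: x => [|x x' IHx IHx'|a x IHx|p].
- by rewrite rng_mul0r !chen_pa_act0.
- by rewrite rng_mulDl !chen_pa_actDl IHx IHx'.
- by rewrite path_algebra_mulZl !chen_pa_actZl IHx.
elim/pa_ind: y => [|y y' IHy IHy'|a y IHy|q].
- by rewrite rng_mulr0 !chen_pa_act0 chen_pa_act0r.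
- by rewrite rng_mulDr !chen_pa_actDl IHy IHy' chen_pa_actDr.
- by rewrite path_algebra_mulZr !chen_pa_actZl IHy chen_pa_actZr.
rewrite [_ ** _]pa_mul_path !chen_pa_act_path.
have [pq|npq] := ptgt p =P psrc q.
  by rewrite (path_mulP _ pq) chen_pa_act_path chen_path_cat.
rewrite path_mul0 // chen_pa_act0 [chen_path q m]/chen_path chen_path_vact.
by case: eqP.
Qed.

Lemma chen_path_edge (g : edge (double E)) m : chen_path (@epath (double E) g) m = gact g m.
Proof. by rewrite /chen_path /= chen_vact_gact. Qed.

Lemma chen_pa_act_ideal x m : leavitt_ideal x -> chen_pa_act x m = 0.
Proof.
move=> Ix; elim: Ix m => {x} [f g|v fs Ufs fs0 fsE||x y _ Ix _ Iy|a x _ Ix|x y _ Iy|x y _ Ix] m.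
- rewrite chen_pa_actDl -scaleN1r chen_pa_actZl scaleN1r chen_pa_actA !chen_pa_act_path.
  rewrite !chen_path_edge; apply/eqP; rewrite subr_eq0; apply/eqP.
  elim/malg_ind: m => [|x y IHx IHy|a x IHx|q].
  + by rewrite !lin_ext0 chen_pa_act0r.
  + by rewrite !lin_extD IHx IHy chen_pa_actDr.
  + by rewrite !lin_extZ IHx chen_pa_actZr.
  rewrite lin_ext1 /=.
  have -> : chen_pa_act (if f == g then pa_vertex K (tgt f) else 0) << q >> =
      if (f == g) && (tgt g == chen_src q) then << q >> else 0.
    case: eqP => [->|_] /=; last by rewrite chen_pa_act0.
    by rewrite chen_pa_act_path /chen_path /= lin_ext1.
  case: eqP => [gq|_]; last by rewrite lin_ext0 andbF.
  rewrite lin_ext1 /= [icat _ _ 0]/icat /= andbT; case: eqP => // _.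
  by congr mkmalgU; apply: val_inj; apply/funext => i; rewrite /= /icat /= subn1.
- rewrite chen_pa_actDl -scaleN1r chen_pa_actZl scaleN1r.
  rewrite (big_morph (chen_pa_act^~ m) (fun x y => chen_pa_actDl x y m) (chen_pa_act0 m)).
  under eq_bigr => f _ do rewrite chen_pa_actA !chen_pa_act_path !chen_path_edge.
  rewrite chen_pa_act_path /chen_path /=; apply/eqP; rewrite subr_eq0; apply/eqP.
  elim/malg_ind: m => [|x y IHx IHy|a x IHx|q].
  + by rewrite lin_ext0 big1 // => f _; rewrite !lin_ext0.
  + rewrite lin_extD IHx IHy -big_split; apply: eq_bigr => f _.
    by rewrite !lin_extD.
  + rewrite lin_extZ IHx scaler_sumr; apply: eq_bigr => f _.
    by rewrite !lin_extZ.
  have edgeK f : gact (inl f) (gact (inr f) << q >>) =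
      if f == chen_val q 0 then << q >> else 0.
    rewrite lin_ext1 /=; case: eqP => [->|_]; last by rewrite lin_ext0.
    have /asboolP[iq _] := chen_valP q.
    rewrite lin_ext1 /=; case: eqP => [tq|[]]; last by rewrite iq.
    congr mkmalgU; apply: val_inj; apply/funext => -[|i] //=.
    by rewrite /icat /= subn1.
  under eq_bigr => f _ do rewrite edgeK.
  rewrite -big_mkcond /= lin_ext1 /chen_vertex -[chen_src q]/(src (chen_val q 0)).
  rewrite eq_sym -fsE; case: ifP => qfs.
    by rewrite -big_filter filter_pred1_uniq // big_seq1.
  rewrite big_seq_cond big1 // => f /andP[ffs /eqP fq].
  by rewrite -fq ffs in qfs.
- exact: chen_pa_act0.
- by rewrite chen_pa_actDl Ix Iy addr0.
- by rewrite chen_pa_actZl Ix scaler0.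
- by rewrite chen_pa_actA Iy chen_pa_act0r.
- by rewrite chen_pa_actA Ix.
Qed.

Lemma chen_act_pi x m : chen_act (leavitt_pi x) m = chen_pa_act x m.
Proof.
apply/eqP; rewrite -subr_eq0 /chen_act -[- chen_pa_act x m]scaleN1r.
rewrite -chen_pa_actZl scaleN1r -chen_pa_actDl.
by rewrite chen_pa_act_ideal //; exact: leavitt_reprP.
Qed.

Fact chen_actDl x y m : chen_act (x + y) m = chen_act x m + chen_act y m.
Proof.
rewrite -[x]leavitt_reprK -[y]leavitt_reprK -leavitt_piD !chen_act_pi.
exact: chen_pa_actDl.
Qed.

Fact chen_actDr x m m' : chen_act x (m + m') = chen_act x m + chen_act x m'.
Proof. exact: chen_pa_actDr. Qed.

Fact chen_actA x y m : chen_act (x ** y) m = chen_act x (chen_act y m).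
Proof.
rewrite -[x]leavitt_reprK -[y]leavitt_reprK -leavitt_pi_mul !chen_act_pi.
exact: chen_pa_actA.
Qed.

Definition chen_module : lmodule L := LModule chen_actDl chen_actDr chen_actA.

Lemma chen_module_vertex v q :
  @lact L chen_module (lvertex K v) << q >> = chen_vertex v q.
Proof. by rewrite /= chen_act_pi chen_pa_act_path /chen_path /= lin_ext1. Qed.

Lemma chen_module_edge f q :
  @lact L chen_module (ledge K f) << q >> = chen_edge (inl f) q.
Proof. by rewrite /= chen_act_pi chen_pa_act_path chen_path_edge lin_ext1. Qed.

Lemma chen_module_ghost f q :
  @lact L chen_module (lghost K f) << q >> = chen_edge (inr f) q.
Proof. by rewrite /= chen_act_pi chen_pa_act_path chen_path_edge lin_ext1. Qed.

Definition rho_inf (x : L) : chen_module := @lact L chen_module x << chen_inf e >>.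

End ChenModule.

Definition basic_irreducible (K : fieldType) (p : {poly K}) : Prop :=
  [/\ irreducible_poly p, (3 <= size p)%N & p.[0] = -1].

Section ResidueField.
Variables (K : fieldType) (p : {poly K}) (hp : basic_irreducible p).

(* The library forms [K[x]/<h>] for monic [h]; this is the monic generator of
   the ideal [<p>]. *)
Definition monic_generator : {poly K} := (lead_coef p)^-1 *: p.

Fact lead_coef_inv_neq0 : (lead_coef p)^-1 != 0.
Proof.
have [_ sp _] := hp.
by rewrite invr_eq0 lead_coef_eq0 -size_poly_gt0 (leq_trans _ sp).
Qed.

Fact monic_generator_irreducible : monic_irreducible_poly monic_generator.
Proof.
have c0 := lead_coef_inv_neq0; have [[sp irr] _ _] := hp.
split; last by rewrite monicE lead_coefZ mulVf // -invr_eq0.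
split=> [|q sq]; first by rewrite size_scale.
rewrite dvdpZr // => /(irr q sq); rewrite /eqp dvdpZr // dvdpZl //.
Qed.

Definition residue_field : fieldType :=
  {poly %/ monic_generator with monic_generator_irreducible}.

Definition residue_const : {rmorphism K -> residue_field} :=
  GRing.in_alg {poly %/ monic_generator with monic_generator_irreducible}.

Definition xbar : residue_field := in_qpoly monic_generator 'X.

Fact xbar_neq0 : xbar != 0.
Proof.
have c0 := lead_coef_inv_neq0; have [_ sp _] := hp.
apply/eqP => /(congr1 (fun q : {poly %/ monic_generator} => q : {poly K})).
rewrite /xbar /= /in_qpoly /= (mk_monicE monic_generator_irreducible).
rewrite Pdiv.CommonRing.rmodp_small; last by rewrite size_polyX size_scale.
by move/eqP; rewrite polyX_eq0.
Qed.

End ResidueField.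

Section TwistedChen.
Variables (K : fieldType) (E : digraph) (e : graph_cycle E).
Variables (p : {poly K}) (hp : basic_irreducible p).

Definition twisted_chen : lmodule (leavitt K E) :=
  restrict (base_change (residue_const hp) E)
    (restrict (gauge e (xbar_neq0 hp)) (chen_module (residue_field hp) e)).

Definition cycle_power (i : nat) : leavitt K E :=
  iter i (rng_mul (lpath K (cycle_path e))) (lvertex K (cycle_src e)).

(* The constant term is [p_0 s(e)], which is [- s(e)] when [p(0) = -1]. *)
Definition cycle_eval (q : {poly K}) : leavitt K E :=
  \sum_(i < size q) q`_i *: cycle_power i.

Fact cycle_eval_left_mult q : cycle_eval q \in left_mult (lvertex K (cycle_src e)).
Proof.
apply: rpred_sum => i _.
have mulZ a (x : leavitt K E) y : (a *: x) ** y = a *: (x ** y).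
  rewrite -[x]leavitt_reprK -[y]leavitt_reprK -leavitt_pi_scale.
  by rewrite -!leavitt_pi_mul -leavitt_pi_scale path_algebra_mulZl.
apply/asboolP; exists (q`_i *: cycle_power i); rewrite mulZ; congr (_ *: _).
elim: (val i) => [|j IHj]; last first.
  change (cycle_power j.+1) with (lpath K (cycle_path e) ** cycle_power j).
  by rewrite -rng_mulA -IHj.
rewrite /cycle_power /= /lvertex -leavitt_pi_mul; congr leavitt_pi.
rewrite [RHS]pa_mul_path path_mulP; congr (path_elt _ _).
exact: val_inj.
Qed.

End TwistedChen.

(* Main.v *)
Require Import Defs.
From mathcomp Require Import all_boot all_order all_algebra all_field.
From mathcomp Require Import finmap.
From mathcomp.classical Require Import boolp.
From mathcomp.multinomials Require Import monalg.

(** Write [L] for the Leavitt path algebra, [v] for the source of the cycle [e] and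
    [p(e)] for the value of [p] at [e].  The map [L v -> V^p] sends a path [l] ending
    at [v] to a nonzero multiple of the infinite path [l e e e ...], and the cycle
    acts on [e^oo] as the scalar [xbar].  Everything rests on computing in [L v] as
    if it consisted of real paths only.

    Two paths ending at [v] which begin the same infinite path when followed by
    [e e e ...] differ by a power of the cycle.  So a combination of paths ending at
    [v] can, after right multiplication by a power of [e], be written as a sum of
    products [l_q h_q(e)], where [q] runs through distinct infinite paths tail
    equivalent to [e^oo], [l_q] is a fixed path with [q = l_q e e e ...], and [h_q] is
    a polynomial.  Every element of [L] acquires such a normal form after right
    multiplication by a power of [e] ([eventually_normalP]): ghost edges are cancelled
    against the turns of the cycle.  On a normal form the map to the Chen module is
    transparent: it sends it to the combination of the basis vectors [q] with
    coefficients [h_q(xbar)], up to nonzero factors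
    ([twisted_eval_normal_form_eq0]).

    Because [p(0) = -1], we have [p = x g - 1], so [x] is invertible modulo [p] and
    [v] is congruent to a multiple of any power of [e] modulo [p(e)]
    ([vertex_split]); the multiplication by a power of [e] can therefore be undone.
    For the kernel ([twisted_eval_kernel]), an element of the kernel has a normal form
    with [h_q(xbar) = 0], hence with [p] dividing [h_q], and so lies in [L p(e)].  For
    the injectivity of right multiplication by [p(e)] on [L v]
    ([cycle_eval_regular]), the same computation is made with the field [K(x)] and the
    twist [x] in place of [xbar]: there [p(x)] is a nonzero scalar, and [h_q(x) = 0]
    forces [h_q = 0].  Consequently [L p(e)] is isomorphic to [L v], which is
    projective because [v] is idempotent ([left_ideal_projective]).

    The map is onto because every scalar of the residue field is a polynomial in
    [xbar], and so is realized by a polynomial in the cycle.  For simplicity, the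
    ghost of a long enough prefix isolates one term of a nonzero vector and moves it
    to a nonzero multiple of [e^oo] ([invariant_chen_inf]), which generates. *)

Set Implicit Arguments.
Unset Strict Implicit.
Unset Printing Implicit Defensive.

Import GRing.Theory.
Local Open Scope ring_scope.

(** * Principal left ideals *)

Section PrincipalLeftIdeals.
Variables (R : rngType) (w b : R).
Hypothesis wb : w ** b = b.

Fact left_gen_subproof : b \in left_mult b.
Proof. by apply/asboolP; exists w. Qed.

Definition left_gen : left_ideal b := LeftIdeal left_gen_subproof.

Lemma left_ideal_actP (x : left_ideal b) : exists r, x = lact r left_gen.
Proof. by have /asboolP[r xE] := left_valP x; exists r; apply: val_inj. Qed.

Lemma left_ideal_unital : unital (left_ideal b).
Proof.
move=> x; have [r ->] := left_ideal_actP x.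
by exists [:: (r, left_gen)]; rewrite big_seq1.
Qed.

Lemma left_ideal_finitely_generated : finitely_generated (left_ideal b).
Proof.
exists [:: left_gen] => x; have [r ->] := left_ideal_actP x.
by exists (fun=> r); rewrite big_ord1.
Qed.

(** The condition on annihilators makes right multiplication by [b] an isomorphism
    from [R w] onto [R b], and [R w] is projective because [w] is idempotent: a
    homomorphism out of [R w] is determined by the image of [w], which can be any
    element [w y].  With [b = w] this is the projectivity of [R w] itself. *)
Lemma left_ideal_projective :
  w ** w = w -> (forall r, r ** b = 0 -> r ** w = 0) ->
  projective (left_ideal b).
Proof.
move=> ww b_reg; split; first exact: left_ideal_unital.
move=> M N g h _ _ [gD gA] g_surj [hD hA].
have [y gy] := g_surj (h left_gen).
pose coord (x : left_ideal b) : R := sval (cid (left_ideal_actP x)).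
have coordP x : x = lact (coord x) left_gen by rewrite /coord; case: cid.
have coordE (x : left_ideal b) r : x = lact r left_gen -> coord x ** w = r ** w.
  move=> xr; apply/eqP; rewrite -subr_eq0 -rng_mulNr -rng_mulDl; apply/eqP/b_reg.
  rewrite rng_mulDl rng_mulNr; apply/eqP; rewrite subr_eq0; apply/eqP.
  have /= := congr1 (@left_val R b) (coordP x).
  by rewrite {1}xr /= => <-.
exists (fun x => lact (coord x ** w) y).
  split=> [x x'|r x].
    rewrite -lactDl -rng_mulDl (@coordE (x + x') (coord x + coord x')) //.
    by rewrite lactDl -!coordP.
  rewrite -lactA rng_mulA (@coordE (lact r x) (r ** coord x)) //.
  by rewrite lactA -coordP.
move=> x; rewrite gA gy -hA; congr h; rewrite [RHS]coordP lactA.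
by congr lact; apply: val_inj; exact: wb.
Qed.

End PrincipalLeftIdeals.

(** * Products of vertices and edges in a Leavitt path algebra *)

Lemma rng_mul_suml (R : rngType) I (r : seq I) (F : I -> R) (y : R) :
  (\sum_(i <- r) F i) ** y = \sum_(i <- r) F i ** y.
Proof.
by elim/big_rec2: _ => [|i a b _ <-]; rewrite ?rng_mul0r ?rng_mulDl.
Qed.

Lemma rng_mul_sumr (R : rngType) I (r : seq I) (F : I -> R) (y : R) :
  y ** (\sum_(i <- r) F i) = \sum_(i <- r) y ** F i.
Proof. by elim/big_rec2: _ => [|i a b _ <-]; rewrite ?rng_mulr0 ?rng_mulDr. Qed.

Lemma poly_linear_ind (R : nzRingType) (P : {poly R} -> Prop) :
  P 0 -> (forall f g, P f -> P g -> P (f + g)) ->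
  (forall a f, P f -> P (a *: f)) -> (forall n, P 'X^n) -> forall f, P f.
Proof.
move=> P0 PD PZ PX f; rewrite -[f]coefK poly_def.
by apply: big_ind => // i _; exact/PZ/PX.
Qed.

Section LeavittMultiplication.
Variables (K : fieldType) (E : digraph).
Local Notation L := (leavitt K E).
Implicit Types (x y z : L).

Lemma leavitt_mulZl (b : K) x y : (b *: x) ** y = b *: (x ** y).
Proof.
rewrite -[x]leavitt_reprK -[y]leavitt_reprK -leavitt_pi_scale -!leavitt_pi_mul.
by rewrite path_algebra_mulZl leavitt_pi_scale.
Qed.

Lemma leavitt_mulZr (b : K) x y : x ** (b *: y) = b *: (x ** y).
Proof.
rewrite -[x]leavitt_reprK -[y]leavitt_reprK -leavitt_pi_scale -!leavitt_pi_mul.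
by rewrite path_algebra_mulZr leavitt_pi_scale.
Qed.

Definition double_path (p : gpath (Defs.double E)) : L := leavitt_pi (path_elt K p).

Lemma double_pathM (p q : gpath (Defs.double E)) (pq : ptgt p = psrc q) :
  double_path p ** double_path q = double_path (pcat pq).
Proof. by rewrite /double_path -leavitt_pi_mul [_ ** _]pa_mul_path path_mulP. Qed.

Lemma double_pathM0 (p q : gpath (Defs.double E)) : ptgt p <> psrc q ->
  double_path p ** double_path q = 0.
Proof.
move=> pq; rewrite /double_path -leavitt_pi_mul [_ ** _]pa_mul_path path_mul0 //.
exact: leavitt_pi0.
Qed.

Definition double_gen (g : edge (Defs.double E)) : L :=
  double_path (@epath (Defs.double E) g).

(** Turns statements about all monomials of the algebra into inductions which add
    one edge or ghost edge on the left. *)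
Lemma double_pathE (p : gpath (Defs.double E)) :
  double_path p =
    foldr (fun g => rng_mul (double_gen g)) (@lvertex K E (ptgt p)) (pedges p).
Proof.
case: p => [[u l] ul]; rewrite /ptgt /pedges /psrc /=.
elim: l u ul => [|g l IHl] u ul.
  by congr (leavitt_pi (path_elt K _)); apply: val_inj.
case/andP: (ul) => /eqP gu gl.
transitivity (double_gen g ** double_path (@GPath (Defs.double E) (_, l) gl));
  last by rewrite IHl.
rewrite [RHS]double_pathM; congr double_path.
apply: val_inj; congr (_, _); exact: esym gu.
Qed.

Lemma lvertexM (u v : vertex E) :
  lvertex K u ** lvertex K v = if u == v then lvertex K v else 0.
Proof.
case: eqP => [<-|uv]; last by rewrite [LHS]double_pathM0.
by rewrite [LHS]double_pathM; congr double_path; apply: val_inj.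
Qed.

Lemma lvertexK (v : vertex E) : lvertex K v ** lvertex K v = lvertex K v.
Proof. by rewrite lvertexM eqxx. Qed.

Lemma lvertex_edge u (f : edge E) :
  lvertex K u ** ledge K f = if u == src f then ledge K f else 0.
Proof.
case: eqP => [->|uv]; last by rewrite [LHS]double_pathM0.
by rewrite [LHS]double_pathM; congr double_path; apply: val_inj.
Qed.

Lemma ledge_tgt (f : edge E) : ledge K f ** lvertex K (tgt f) = ledge K f.
Proof. by rewrite [LHS]double_pathM; congr double_path; apply: val_inj. Qed.

End LeavittMultiplication.

(** * Paths ending at the base of the cycle, and polynomials in the cycle *)

Section CycleWords.
Variables (K : fieldType) (E : digraph) (e : graph_cycle E).
Local Notation L := (leavitt K E).
Local Notation v := (cycle_src e).
Local Notation C := (cycle_edges e).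
Local Notation pow := (@cycle_power K E e).
Local Notation ev := (@cycle_eval K E e).

Definition word_on (x : L) (l : seq (edge E)) : L :=
  foldr (fun f => rng_mul (ledge K f)) x l.

(** Paths ending at [v] are handled as plain lists of edges: the target is fixed, so
    the product of the edges with [v] at the end is the path, and concatenation
    needs no proof of composability. *)
Definition word (l : seq (edge E)) : L := word_on (lvertex K v) l.

Definition walk (u : vertex E) (l : seq (edge E)) : bool :=
  chain u l && (chain_end u l == v).

Definition turns (i : nat) : seq (edge E) := flatten (nseq i C).

Lemma word_mul l (x : L) : lvertex K v ** x = x -> word l ** x = word_on x l.
Proof. by move=> vx; elim: l => //= f l IHl; rewrite -rng_mulA IHl. Qed.

Lemma vertex_word u w l : walk w l ->
  lvertex K u ** word l = if u == w then word l else 0.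
Proof.
case: l => [|f l] /andP[] /=; first by move=> _ /eqP <-; rewrite lvertexM.
move=> /andP[/eqP <- _] _; rewrite rng_mulA lvertex_edge.
by case: ifP => // _; rewrite rng_mul0r.
Qed.

Lemma edge_word f w l : walk w l ->
  ledge K f ** word l = if tgt f == w then word (f :: l) else 0.
Proof.
move=> wl; rewrite -[in LHS]ledge_tgt -rng_mulA (vertex_word _ wl).
by case: ifP => // _; rewrite rng_mulr0.
Qed.

Lemma ghost_word f g l : walk (tgt g) l ->
  lghost K f ** word (g :: l) = if f == g then word l else 0.
Proof.
move=> gl; rewrite /= rng_mulA leavitt_CK1; case: eqP => [->|_].
  by rewrite (vertex_word _ gl) eqxx.
by rewrite rng_mul0r.
Qed.

Lemma walk_turns i : walk v (turns i).
Proof.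
rewrite /walk; elim: i => [|i /andP[ci ei]]; first by rewrite /= eqxx.
have cC : chain v C := cycle_chain e; have eC : chain_end v C = v := cycle_closed e.
have -> : turns i.+1 = C ++ turns i by [].
by rewrite chain_cat chain_end_cat cC eC ci ei.
Qed.

Lemma cycle_powerS i : pow i.+1 = word_on (pow i) C.
Proof.
have vpow : lvertex K v ** pow i = pow i.
  have vC : lvertex K v ** lpath K (Defs.cycle_path e) = lpath K (Defs.cycle_path e).
    by rewrite [LHS]double_pathM; congr (double_path K _); apply: val_inj.
  by case: i => [|i]; [exact: lvertexK|rewrite /= rng_mulA vC].
change (pow i.+1) with (lpath K (Defs.cycle_path e) ** pow i).
have eC : @ptgt (Defs.double E) (real_path (Defs.cycle_path e)) = v.
  rewrite /ptgt /chain_end -map_comp; exact: (cycle_closed e).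
by rewrite [lpath _ _]double_pathE foldr_map eC -(word_mul _ vpow).
Qed.

Lemma cycle_powerE i : pow i = word (turns i).
Proof.
elim: i => // i IHi; rewrite cycle_powerS IHi.
by rewrite /word /word_on -foldr_cat.
Qed.

Lemma vertex_cycle_power i : lvertex K v ** pow i = pow i.
Proof. by rewrite cycle_powerE (vertex_word _ (walk_turns i)) eqxx. Qed.

Lemma word_cycle_power l i : word l ** pow i = word (l ++ turns i).
Proof.
by rewrite (word_mul _ (vertex_cycle_power i)) cycle_powerE /word /word_on -foldr_cat.
Qed.

Lemma cycle_powerD i j : pow i ** pow j = pow (i + j)%N.
Proof.
by rewrite {1}cycle_powerE word_cycle_power cycle_powerE /turns nseqD flatten_cat.
Qed.

Lemma cycle_evalE n (q : {poly K}) : (size q <= n)%N ->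
  ev q = \sum_(i < n) q`_i *: pow i.
Proof.
move=> qn; rewrite /cycle_eval (big_ord_widen n (fun i => q`_i *: pow i)) //.
rewrite big_mkcond; apply: eq_bigr => i _; case: ltnP => // qi.
by rewrite nth_default // scale0r.
Qed.

Lemma cycle_evalD (f g : {poly K}) : ev (f + g) = ev f + ev g.
Proof.
pose n := maxn (size f) (size g).
rewrite !(@cycle_evalE n) ?size_polyD ?leq_maxl ?leq_maxr // -big_split.
by apply: eq_bigr => i _; rewrite coefD scalerDl.
Qed.

Lemma cycle_evalZ a (f : {poly K}) : ev (a *: f) = a *: ev f.
Proof.
rewrite (@cycle_evalE (size f)) ?size_scale_leq // scaler_sumr.
by apply: eq_bigr => i _; rewrite coefZ scalerA.
Qed.

Lemma cycle_eval0 : ev 0 = 0.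
Proof. by rewrite /cycle_eval size_poly0 big_ord0. Qed.

Lemma cycle_evalXn n : ev 'X^n = pow n.
Proof.
rewrite /cycle_eval size_polyXn big_ord_recr /= big1 ?add0r => [|i _].
  by rewrite coefXn eqxx scale1r.
by rewrite coefXn ltn_eqF ?scale0r.
Qed.

Lemma cycle_eval1 : ev 1 = lvertex K v.
Proof. exact: (cycle_evalXn 0). Qed.

(** Evaluation at the cycle is a ring homomorphism from [K[x]] to the corner
    [v L v], whose unit is [v]. *)
Lemma cycle_evalM (f g : {poly K}) : ev (f * g) = ev f ** ev g.
Proof.
elim/poly_linear_ind: f => [|f f' IHf IHf'|a f IHf|n].
- by rewrite mul0r cycle_eval0 rng_mul0r.
- by rewrite mulrDl !cycle_evalD IHf IHf' rng_mulDl.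
- by rewrite -scalerAl !cycle_evalZ IHf leavitt_mulZl.
elim/poly_linear_ind: g => [|g g' IHg IHg'|a g IHg|m].
- by rewrite mulr0 cycle_eval0 rng_mulr0.
- by rewrite mulrDr !cycle_evalD IHg IHg' rng_mulDr.
- by rewrite -scalerAr !cycle_evalZ IHg leavitt_mulZr.
by rewrite -exprD !cycle_evalXn cycle_powerD.
Qed.

Lemma cycle_evalC (f g : {poly K}) : ev f ** ev g = ev g ** ev f.
Proof. by rewrite -!cycle_evalM mulrC. Qed.

Lemma vertex_cycle_eval (f : {poly K}) : lvertex K v ** ev f = ev f.
Proof. by rewrite -cycle_eval1 -cycle_evalM mul1r. Qed.

Lemma word_vertex l : word l ** lvertex K v = word l.
Proof. by rewrite (word_mul _ (lvertexK K v)). Qed.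

End CycleWords.

(** * Normal forms up to a power of the cycle *)

Section NormalForm.
Variables (K : fieldType) (E : digraph) (e : graph_cycle E).
Local Notation L := (leavitt K E).
Local Notation v := (cycle_src e).
Local Notation C := (cycle_edges e).
Local Notation inf := (cycle_inf e).
Local Notation pow := (@cycle_power K E e).
Local Notation ev := (@cycle_eval K E e).
Local Notation word := (@word K E e).
Local Notation walk := (walk e).
Local Notation turns := (turns e).

Lemma icat_cat l l' (q : nat -> edge E) : icat (l ++ l') q = icat l (icat l' q).
Proof.
apply/funext => i; rewrite /icat size_cat nth_cat.
case: (ltnP i (size l)) => il; first by rewrite ltn_addr //; exact: set_nth_default.
by rewrite -ltn_subLR // subnDA.
Qed.

Lemma icat_cycle : icat C inf = inf.
Proof.
apply/funext => i; rewrite /icat; case: ltnP => iC.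
  by rewrite [RHS]/cycle_inf modn_small //; exact: set_nth_default.
by rewrite /cycle_inf -{2}(subnK iC) modnDr.
Qed.

Lemma icat_turns i : icat (turns i) inf = inf.
Proof.
elim: i => [|i IHi]; first by apply/funext => i; rewrite /icat /= subn0.
have -> : turns i.+1 = C ++ turns i by [].
by rewrite icat_cat IHi icat_cycle.
Qed.

Lemma icat_walk0 w l : walk w l -> src (icat l inf 0) = w.
Proof.
case: l => [|f l] /andP[].
  by move=> _ /eqP wv; rewrite -[w]/(chain_end w [::]) wv.
by case/andP=> /eqP <-.
Qed.

(** Any path ending at [v] can be prolonged by the periodic path [e e e ...], which
    yields a basis vector of the Chen module. *)
Lemma walk_infinite w l : walk w l ->
  exists2 q : chen_basis e, chen_val q = icat l inf & chen_src q = w.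
Proof.
elim: l w => [|f l IHl] w wl.
  case/andP: (wl) => _ /eqP /= wv.
  exists (chen_inf e); last by rewrite -[w]/(chain_end w [::]) wv.
  by apply/funext => i; rewrite /icat /= subn0.
case/andP: wl => /= /andP[/eqP fw fl] lv.
have [|q qE qs] := IHl (tgt f); first by apply/andP.
have fq : tgt f = chen_src q by rewrite qs.
exists (chen_cons fq) => //.
by rewrite /= qE -icat_cat.
Qed.

Lemma size_turns i : size (turns i) = (i * size C)%N.
Proof. by elim: i => //= i IHi; rewrite size_cat IHi. Qed.

Lemma nth_turns f i j : (j < i * size C)%N -> nth f (turns i) j = inf j.
Proof.
move=> ji; rewrite -[in RHS](icat_turns i) /icat size_turns ji.
by apply: set_nth_default; rewrite size_turns.
Qed.

(** Comparing the two infinite paths at position [size l'] shows that [e_1] occurs in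
    the periodic path at position [size l' - size l].  The edges of a cycle are
    pairwise distinct, so this difference is a multiple of the length of the cycle. *)
Lemma icat_inj_turns l l' : icat l inf = icat l' inf -> (size l <= size l')%N ->
  exists i, l' = l ++ turns i.
Proof.
move=> ll' le_ll'; have UC : uniq C := map_uniq (cycle_uniq e).
set d := (size l' - size l)%N.
have dC : (d %% size C = 0)%N.
  have /(congr1 (@^~ (size l'))) := ll'.
  rewrite /icat ltnn subnn ltnNge le_ll' /= -/d /cycle_inf mod0n => /eqP.
  by rewrite nth_uniq ?ltn_mod // => /eqP.
exists (d %/ size C)%N.
have dE : (d %/ size C * size C = d)%N by rewrite [RHS](divn_eq d (size C)) dC addn0.
apply: (@eq_from_nth _ (cycle_head e)).
  by rewrite size_cat size_turns dE subnKC.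
move=> i il'; rewrite nth_cat.
have /(congr1 (@^~ i)) := ll'; rewrite /icat il' => lE.
rewrite (set_nth_default (inf 0)) // -lE; case: ltnP => il.
  exact: set_nth_default.
by rewrite nth_turns // dE ltn_sub2r // (leq_ltn_trans il).
Qed.

Lemma chen_basis_walk (q : chen_basis e) :
  exists l, walk (chen_src q) l && `[< chen_val q = icat l inf >].
Proof.
have /asboolP[_ [p [pe qE]]] := chen_valP q.
have wp : walk (psrc p) (pedges p) by apply/andP; rewrite gpathP -/(ptgt p) pe.
exists (pedges p); apply/andP; split; last exact/asboolP.
by have := icat_walk0 wp; rewrite -qE -/(chen_src q) => ->.
Qed.

(** A choice of one path [l], ending at [v], for each basis vector
    [q = l e e e ...]; any other path with this property differs from [stem q] by a
    power of the cycle. *)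
Definition stem (q : chen_basis e) : seq (edge E) := xchoose (chen_basis_walk q).

Lemma stem_walk q : walk (chen_src q) (stem q).
Proof. by have /andP[] := xchooseP (chen_basis_walk q). Qed.

Lemma stemE q : chen_val q = icat (stem q) inf.
Proof. by have /andP[_ /asboolP] := xchooseP (chen_basis_walk q). Qed.

(** The sum over [q] of [stem q] times the value at the cycle of the polynomial
    attached to [q]: a linear combination of real paths, sorted by the infinite path
    that they begin when followed by [e e e ...]. *)
Definition normal_form (h : {malg {poly K}[chen_basis e]}) : L :=
  \sum_(q <- msupp h) word (stem q) ** ev h@_q.

Lemma normal_formEw (d : {fset chen_basis e}) h : (msupp h `<=` d)%fset ->
  normal_form h = \sum_(q <- d) word (stem q) ** ev h@_q.
Proof.
move=> hd; apply: big_fset_incl => // q _ qh.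
by rewrite mcoeff_outdom // cycle_eval0 rng_mulr0.
Qed.

Lemma normal_formD h h' : normal_form (h + h') = normal_form h + normal_form h'.
Proof.
pose d := (msupp h `|` msupp h')%fset.
rewrite !(@normal_formEw d) ?fsubsetUl ?fsubsetUr ?msuppD_le // -big_split /=.
by apply: eq_bigr => q _; rewrite mcoeffD cycle_evalD rng_mulDr.
Qed.

Lemma normal_formM h f : normal_form h ** ev f = normal_form (f *: h).
Proof.
rewrite [RHS](@normal_formEw (msupp h)) ?msuppZ_le // rng_mul_suml.
by apply: eq_bigr => q _; rewrite mcoeffZ mulrC cycle_evalM rng_mulA.
Qed.

Lemma normal_formU q f : normal_form << f *g q >> = word (stem q) ** ev f.
Proof.
by rewrite (@normal_formEw [fset q]%fset) ?msuppU_le // big_seq_fset1 mcoeffUU.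
Qed.

Lemma normal_form0 : normal_form 0 = 0.
Proof. by rewrite /normal_form msupp0 big_seq_fset0. Qed.

(** A power of the cycle on the right cancels the ghost edges that follow the cycle
    and kills the monomials whose ghost edges leave it; this is how elements of the
    algebra become combinations of real paths. *)
Definition eventually_normal (x : L) : Prop :=
  exists m h, x ** pow m = normal_form h.

Lemma eventually_normal0 : eventually_normal 0.
Proof. by exists 0, 0; rewrite rng_mul0r normal_form0. Qed.

Lemma eventually_normalM x f : eventually_normal x -> eventually_normal (x ** ev f).
Proof.
case=> m [h xE]; exists m, (f *: h).
by rewrite -normal_formM -xE -!rng_mulA -!cycle_evalXn cycle_evalC.
Qed.

Lemma eventually_normal_pow x m :
  eventually_normal (x ** pow m) -> eventually_normal x.
Proof.
by case=> n [h xE]; exists (m + n)%N, h; rewrite -xE -rng_mulA cycle_powerD.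
Qed.

Lemma eventually_normalD x y :
  eventually_normal x -> eventually_normal y -> eventually_normal (x + y).
Proof.
move=> [m [h xE]] [n [k yE]]; exists (m + n)%N, ('X^n *: h + 'X^m *: k).
rewrite normal_formD -!normal_formM -xE -yE rng_mulDl !cycle_evalXn.
rewrite -!rng_mulA !cycle_powerD.
by rewrite [(n + m)%N]addnC.
Qed.

Lemma eventually_normalZ a x : eventually_normal x -> eventually_normal (a *: x).
Proof.
case=> m [h xE]; exists m, (a%:P *: h).
rewrite -normal_formM -xE leavitt_mulZl -rng_mulA -alg_polyC cycle_evalZ cycle_eval1.
by rewrite leavitt_mulZr -[lvertex K v]/(pow 0) cycle_powerD addn0 leavitt_mulZr.
Qed.

(** [l] and the stem of [l e e e ...] begin the same infinite path, so one of them
    is the other followed by turns of the cycle.  If the stem is the longer one, the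
    missing turns are supplied by the power of the cycle. *)
Lemma eventually_normal_word w l : walk w l -> eventually_normal (word l).
Proof.
move=> wl; have [q qE _] := walk_infinite wl.
have ll' : icat l inf = icat (stem q) inf by rewrite -qE -stemE.
have [le_ll'|/ltnW le_l'l] := leqP (size l) (size (stem q)).
  have [i stE] := icat_inj_turns ll' le_ll'.
  exists i, << 1 *g q >>.
  by rewrite normal_formU cycle_eval1 word_vertex word_cycle_power -stE.
have [i lE] := icat_inj_turns (esym ll') le_l'l.
exists 0, << 'X^i *g q >>.
by rewrite normal_formU cycle_evalXn !word_cycle_power -lE cats0.
Qed.

(** An edge makes the path longer or kills it.  A ghost edge removes the first edge
    or kills the path; if there is no first edge, one turn of the cycle supplies
    it. *)
Lemma eventually_normal_gen_word g w l :
  walk w l -> eventually_normal (double_gen K g ** word l).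
Proof.
case: g => f wl.
  rewrite [_ ** _](edge_word K f wl).
  case: eqP => [fw|_]; last exact: eventually_normal0.
  apply: (@eventually_normal_word (src f)); case/andP: wl => wl lv.
  by apply/andP; rewrite -fw in wl lv; rewrite /= eqxx.
wlog [g [l' lE]] : w l wl / exists g l', l = g :: l'.
  case: l wl => [_|g l wl] IH; last by apply: IH wl _; exists g, l.
  apply: (@eventually_normal_pow _ 1); rewrite -rng_mulA word_cycle_power.
  by apply: IH (walk_turns e 1) _; do 2!eexists.
have wl' : walk (tgt g) l'.
  by move: wl; rewrite lE => /andP[/= /andP[_ gl] lv]; apply/andP.
rewrite lE [_ ** _](ghost_word K f wl'); case: eqP => [_|_].
  exact: eventually_normal_word wl'.
exact: eventually_normal0.
Qed.

Lemma eventually_normal_gen g x :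
  eventually_normal x -> eventually_normal (double_gen K g ** x).
Proof.
case=> m [h xE]; apply: (@eventually_normal_pow _ m); rewrite -rng_mulA xE rng_mul_sumr.
elim/big_ind: _ => [||q _]; [exact: eventually_normal0|exact: eventually_normalD|].
rewrite rng_mulA; apply: eventually_normalM.
exact: eventually_normal_gen_word (stem_walk q).
Qed.

Lemma eventually_normalP x : eventually_normal x.
Proof.
rewrite -[x]leavitt_reprK; elim/pa_ind: (leavitt_repr x) => [|y z|a y|p].
- by rewrite leavitt_pi0; exact: eventually_normal0.
- by rewrite leavitt_piD; exact: eventually_normalD.
- by rewrite leavitt_pi_scale; exact: eventually_normalZ.
rewrite [leavitt_pi _]double_pathE; elim: (pedges p) => [|g l IHl].
  apply: (@eventually_normal_pow _ 0).
  rewrite [_ ** _]lvertexM; case: ifP => _; last exact: eventually_normal0.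
  exact: eventually_normal_word (walk_turns e 0).
exact: eventually_normal_gen.
Qed.

End NormalForm.

(** * The twisted evaluation at the periodic infinite path *)

Section Evaluation.
Variables (K S : fieldType) (c : {rmorphism K -> S}).
Variables (E : digraph) (e : graph_cycle E) (a : S) (a_neq0 : a != 0).
Local Notation L := (leavitt K E).
Local Notation V := {malg S[chen_basis e]}.
Local Notation v := (cycle_src e).
Local Notation C := (cycle_edges e).
Local Notation inf := (cycle_inf e).
Local Notation pow := (@cycle_power K E e).
Local Notation ev := (@cycle_eval K E e).
Local Notation word := (@word K E e).
Local Notation walk := (walk e).
Local Notation turns := (turns e).
Local Notation act := (@chen_act S E e).

Lemma chen_actZl b x (m : V) : act (b *: x) m = b *: act x m.
Proof.
by rewrite -[x]leavitt_reprK -leavitt_pi_scale !chen_act_pi chen_pa_actZl.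
Qed.

Lemma chen_actZr b x (m : V) : act x (b *: m) = b *: act x m.
Proof. by rewrite -[x]leavitt_reprK !chen_act_pi chen_pa_actZr. Qed.

Definition twist (x : L) : leavitt S E := gauge e a_neq0 (base_change c E x).

Lemma twistD x y : twist (x + y) = twist x + twist y.
Proof. by rewrite /twist !rng_homD. Qed.

Lemma twistM x y : twist (x ** y) = twist x ** twist y.
Proof. by rewrite /twist !rng_homM. Qed.

Lemma twistZ b x : twist (b *: x) = c b *: twist x.
Proof. by rewrite /twist /base_change weight_homZ gaugeZ. Qed.

Lemma twist_vertex u : twist (lvertex K u) = lvertex S u.
Proof. by rewrite /twist /base_change weight_hom_vertex gauge_vertex. Qed.

Lemma twist_edge f : twist (ledge K f) = gauge_weight e a f *: ledge S f.
Proof.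
by rewrite /twist /base_change weight_hom_edge scale1r [LHS]weight_hom_edge.
Qed.

Lemma twist_ghost f : twist (lghost K f) = (gauge_weight e a f)^-1 *: lghost S f.
Proof.
by rewrite /twist /base_change weight_hom_ghost invr1 scale1r [LHS]weight_hom_ghost.
Qed.

(** The map [x |-> sigma(x) e^oo] for an arbitrary extension [c] of scalars and an
    arbitrary twist [a], so that it can be used both over the residue field of [p]
    and with a transcendental [a]. *)
Definition twisted_eval (x : L) : V := act (twist x) << chen_inf e >>.

Lemma twisted_evalD x y : twisted_eval (x + y) = twisted_eval x + twisted_eval y.
Proof. by rewrite /twisted_eval twistD chen_actDl. Qed.

Lemma twisted_evalZ b x : twisted_eval (b *: x) = c b *: twisted_eval x.
Proof. by rewrite /twisted_eval twistZ chen_actZl. Qed.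

Lemma twisted_eval0 : twisted_eval 0 = 0.
Proof. by rewrite -(scale0r (0 : L)) twisted_evalZ rmorph0 scale0r. Qed.

Lemma twisted_evalM x y : twisted_eval (x ** y) = act (twist x) (twisted_eval y).
Proof. by rewrite /twisted_eval twistM chen_actA. Qed.

Lemma twisted_eval_vertex : twisted_eval (lvertex K v) = << chen_inf e >>.
Proof.
by rewrite /twisted_eval twist_vertex [LHS]chen_module_vertex /chen_vertex eqxx.
Qed.

Definition word_weight (l : seq (edge E)) : S := \prod_(f <- l) gauge_weight e a f.

Lemma word_weight_neq0 l : word_weight l != 0.
Proof. by rewrite prodf_seq_neq0; apply/allP => f _; exact: gauge_weight_neq0. Qed.

(** The twisted edge [e_1] occurs exactly once in the cycle. *)
Lemma word_weight_cycle : word_weight C = a.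
Proof.
rewrite /word_weight big_cons /gauge_weight eqxx big_seq big1 ?mulr1 // => f fC.
case: eqP => // fe; have := map_uniq (cycle_uniq e).
by rewrite /= -fe fC.
Qed.

Lemma twisted_eval_word w l (q : chen_basis e) :
  walk w l -> chen_val q = icat l inf ->
  twisted_eval (word l) = word_weight l *: << q >>.
Proof.
elim: l w q => [|f l IHl] w q.
  move=> _ qE; rewrite /word_weight big_nil scale1r [LHS]twisted_eval_vertex.
  congr mkmalgU; apply: val_inj; rewrite /= qE; apply/funext => i.
  by rewrite /icat subn0.
case/andP=> /= /andP[/eqP fw fl] lv qE.
have fl_walk : walk (tgt f) l by apply/andP.
have [q' q'E q's] := walk_infinite fl_walk.
have fq' : tgt f = chen_src q' by rewrite q's.
rewrite twisted_evalM (IHl _ _ fl_walk q'E) chen_actZr twist_edge chen_actZl scalerA.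
rewrite [word_weight (f :: l)]/word_weight big_cons [_ * word_weight l]mulrC.
rewrite [_ * gauge_weight _ _ _]mulrC [act _ _]chen_module_edge /=.
case: (tgt f =P chen_src q') => [fq|nfq]; last by case: (nfq fq').
by congr (_ *: mkmalgU _ _); apply: val_inj; rewrite /= qE q'E -icat_cat.
Qed.

Lemma twisted_eval_cycle : twisted_eval (pow 1) = a *: << chen_inf e >>.
Proof.
have infE : chen_val (chen_inf e) = icat (turns 1) inf by rewrite icat_turns.
rewrite cycle_powerE (twisted_eval_word (walk_turns e 1) infE).
by rewrite /turns /= cats0 word_weight_cycle.
Qed.

(** The twisted cycle acts on [e^oo] as the scalar [a]. *)
Lemma twisted_evalMeval x f :
  twisted_eval (x ** ev f) = (map_poly c f).[a] *: twisted_eval x.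
Proof.
elim/poly_linear_ind: f => [|f g IHf IHg|b f IHf|n].
- by rewrite cycle_eval0 rng_mulr0 twisted_eval0 rmorph0 horner0 scale0r.
- by rewrite cycle_evalD rng_mulDr twisted_evalD IHf IHg rmorphD hornerD scalerDl.
- by rewrite cycle_evalZ leavitt_mulZr twisted_evalZ IHf map_polyZ hornerZ scalerA.
rewrite cycle_evalXn map_polyXn hornerXn.
elim: n => [|n IHn]; first by rewrite scale1r twisted_evalM twisted_eval_vertex.
rewrite -addn1 -cycle_powerD rng_mulA twisted_evalM twisted_eval_cycle chen_actZr.
rewrite -/(twisted_eval _) IHn.
by rewrite scalerA addn1 exprS.
Qed.

Lemma twisted_eval_normal_form (h : {malg {poly K}[chen_basis e]}) q :
  (twisted_eval (normal_form h))@_q = (map_poly c h@_q).[a] * word_weight (stem q).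
Proof.
rewrite /normal_form (big_morph twisted_eval twisted_evalD twisted_eval0).
under eq_bigr => r _ do
  rewrite twisted_evalMeval (twisted_eval_word (stem_walk r) (stemE r)) scalerA.
rewrite (big_morph (mcoeff q) (mcoeffD q) (mcoeff0 q)).
under eq_bigr => r _ do rewrite mcoeffZ mcoeffU.
have [qh|qh] := boolP (q \in msupp h); last first.
  rewrite mcoeff_outdom // rmorph0 horner0 mul0r big_seq big1 // => r rh.
  by case: eqP => [rq|_]; [rewrite -rq rh in qh|exact: mulr0].
rewrite (bigD1_seq q) //= eqxx mulr1 big1 ?addr0 // => r /negPf->.
by rewrite mulr0.
Qed.

(** The stems of distinct infinite paths are sent to multiples of distinct basis
    vectors, so the polynomials in a normal form are evaluated independently of each
    other. *)
Lemma twisted_eval_normal_form_eq0 (h : {malg {poly K}[chen_basis e]}) :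
  twisted_eval (normal_form h) = 0 -> forall q, (map_poly c h@_q).[a] = 0.
Proof.
move=> h0 q; have /eqP := twisted_eval_normal_form h q.
rewrite h0 mcoeff0 eq_sym mulf_eq0.
by rewrite (negPf (word_weight_neq0 _)) orbF => /eqP.
Qed.

End Evaluation.

(** * Arithmetic of the polynomial and its residue field *)

Section Residues.
Variables (K : fieldType) (p : {poly K}).

(** Base field extension [K -> K(x)], with the transcendental twist [x]: there the
    evaluation of polynomials is injective. *)
Definition frac_const : {rmorphism K -> {fraction {poly K}}} :=
  (@tofrac {poly K}) \o (@polyC K).

Definition frac_X : {fraction {poly K}} := tofrac 'X.

Lemma frac_X_neq0 : frac_X != 0.
Proof. by rewrite /frac_X tofrac_eq0 polyX_eq0. Qed.

Lemma frac_eval (f : {poly K}) : (map_poly frac_const f).[frac_X] = tofrac f.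
Proof.
by rewrite /frac_const map_poly_comp horner_map -/(comp_poly _ _) comp_polyXr.
Qed.

Hypothesis hp : basic_irreducible p.

Lemma basic_irreducible_factor : exists g, p = 'X * g - 1.
Proof.
have [_ _ p0] := hp.
have /factor_theorem[g pE] : root (p + 1) 0 by rewrite rootE !hornerE p0 addNr.
by exists g; rewrite mulrC -[X in g * X](subr0 'X) -pE addrK.
Qed.

(** Since [p(0) = -1], the polynomial [p] has the form [x g - 1], so [x] is invertible
    modulo [p], with inverse [g]. *)
Lemma basic_irreducible_inverse :
  exists g : {poly K}, forall m, exists u, 'X^m * g ^+ m = 1 + p * u.
Proof.
have [g pE] := basic_irreducible_factor; exists g => m.
exists (\sum_(i < m) ('X * g) ^+ i).
by rewrite {1}pE -subrX1 exprMn addrC subrK.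
Qed.

Local Notation mgen := (monic_generator p).
Local Notation F := (residue_field hp).

Lemma residue_eval (f : {poly K}) :
  (map_poly (residue_const hp) f).[xbar hp] = in_qpoly mgen f :> F.
Proof.
elim/poly_ind: f => [|f a IHf].
  by rewrite rmorph0 horner0 rmorph0.
rewrite rmorphD rmorphM /= map_polyX map_polyC hornerMXaddC IHf.
by rewrite -[in RHS]alg_polyC in_qpolyD in_qpolyM in_qpolyZ in_qpoly1.
Qed.

Lemma residue_eval_eq0 (f : {poly K}) :
  (map_poly (residue_const hp) f).[xbar hp] = 0 -> exists u, f = u * p.
Proof.
rewrite residue_eval => /(congr1 (fun q : {poly %/ mgen} => q : {poly K})).
rewrite /= (mk_monicE (monic_generator_irreducible hp)) => /eqP.
move=> f0; suff /dvdpP[u ->] : p %| f by exists u.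
rewrite -(@dvdpZl _ (lead_coef p)^-1); last exact: lead_coef_inv_neq0.
by rewrite Pdiv.Idomain.dvdpE.
Qed.

Lemma residue_eval_root : (map_poly (residue_const hp) p).[xbar hp] = 0.
Proof.
rewrite residue_eval; apply: val_inj.
rewrite /= (mk_monicE (monic_generator_irreducible hp)); apply/eqP.
suff : mgen %| p by rewrite Pdiv.Idomain.dvdpE.
by rewrite dvdpZl //; exact: lead_coef_inv_neq0.
Qed.

Lemma residue_eval_surj (k : F) :
  exists f, (map_poly (residue_const hp) f).[xbar hp] = k.
Proof.
exists (k : {poly %/ mgen}); rewrite residue_eval; apply: val_inj.
exact: (in_qpoly_small (size_mk_monic (k : {poly %/ mgen}))).
Qed.

End Residues.

(** * Surjectivity and simplicity *)

Section Irreducibility.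
Variables (K S : fieldType) (c : {rmorphism K -> S}).
Variables (E : digraph) (e : graph_cycle E) (a : S) (a_neq0 : a != 0).
Hypothesis eval_surj : forall k, exists f, (map_poly c f).[a] = k.
Local Notation V := {malg S[chen_basis e]}.
Local Notation C := (cycle_edges e).
Local Notation ev := (@cycle_eval K E e).
Local Notation act := (@chen_act S E e).
Local Notation twist := (twist c e a_neq0).
Local Notation twisted_eval := (@twisted_eval K S c E e a a_neq0).

(** When every scalar is the value at [a] of a polynomial over the small field, the
    polynomials in the cycle supply all scalars.  So the image of [L],
    a priori a vector space over the small field only, is all of [V]. *)
Lemma twisted_eval_surj (m : V) : exists l, twisted_eval l = m.
Proof.
elim/malg_ind: m => [|x y [l lx] [l' ly]|b x [l lx]|q].
- by exists 0; exact: twisted_eval0.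
- by exists (l + l'); rewrite twisted_evalD lx ly.
- by have [f fb] := eval_surj b; exists (l ** ev f); rewrite twisted_evalMeval fb lx.
have [f fb] := eval_surj (word_weight e a (stem q))^-1.
exists (word K e (stem q) ** ev f).
rewrite twisted_evalMeval fb (twisted_eval_word _ _ (stem_walk q) (stemE q)) scalerA.
by rewrite mulVf ?scale1r //; exact: word_weight_neq0.
Qed.

(** The action of [l^*], as an operator rather than as an element of the algebra: the
    empty list acts as the identity, and the algebra may have no unit. *)
Definition ghosts_act (l : seq (edge E)) (m : V) : V :=
  foldl (fun m f => act (twist (lghost K f)) m) m l.

Lemma ghosts_actD l m m' : ghosts_act l (m + m') = ghosts_act l m + ghosts_act l m'.
Proof. by elim: l m m' => //= f l IHl m m'; rewrite chen_actDr IHl. Qed.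

Lemma ghosts_actZ l b m : ghosts_act l (b *: m) = b *: ghosts_act l m.
Proof. by elim: l m => //= f l IHl m; rewrite chen_actZr IHl. Qed.

Lemma ghosts_act0 l : ghosts_act l 0 = 0.
Proof. by rewrite -(scale0r (0 : V)) ghosts_actZ !scale0r. Qed.

(** The ghost of a path removes this path from the infinite paths which begin with it
    and kills the others.  The scalar is the inverse of the weight of [l]; only
    that it is nonzero and does not depend on [q] matters. *)
Lemma ghosts_act_basis l : exists2 b : S, b != 0 &
  forall q : chen_basis e, ghosts_act l << q >> =
    if l == mkseq q (size l) then b *: << iter (size l) (@chen_tail E e) q >>
    else 0.
Proof.
elim: l => [|f l [b b0 IHl]].
  by exists 1 => [|q]; rewrite ?oner_neq0 //= scale1r.
exists ((gauge_weight e a f)^-1 * b) => [|q].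
  by rewrite mulf_neq0 // invr_neq0 // gauge_weight_neq0.
rewrite [ghosts_act _ _]/= twist_ghost chen_actZl ghosts_actZ.
rewrite [act _ _]chen_module_ghost /chen_edge.
rewrite [size _]/= /mkseq /= eqseq_cons (iotaDl 1 0) -map_comp.
case: (f == chen_val q 0); last by rewrite ghosts_act0 scaler0.
rewrite IHl -[mkseq _ _]/(map (fun i => chen_val q i.+1) (iota 0 (size l))) /=.
case: (l == map _ _); last exact: scaler0.
by rewrite scalerA -iterSr iterS.
Qed.

Lemma ghosts_act_sum l m :
  ghosts_act l m = \sum_(q <- msupp m) m@_q *: ghosts_act l << q >>.
Proof.
rewrite {1}[m]monalgE (big_morph (ghosts_act l) (ghosts_actD l) (ghosts_act0 l)).
apply: eq_bigr => q _; rewrite -ghosts_actZ; congr ghosts_act.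
by apply/malgP => r; rewrite mcoeffZ !mcoeffU mulrnAr mulr1.
Qed.

Lemma prefix_separation (q : chen_basis e) (s : seq (chen_basis e)) :
  exists n, forall r, r \in s ->
    (forall i, (i < n)%N -> chen_val r i = chen_val q i) -> r = q.
Proof.
elim: s => [|r s [n IHs]]; first by exists 0.
have [rq|rq] := EM (r = q).
  by exists n => r'; rewrite inE => /orP[/eqP -> _|/IHs].
have [i iP] : exists i, chen_val r i <> chen_val q i.
  by apply/existsNP => rq'; apply/rq/val_inj/funext.
exists (maxn n i.+1) => r'; rewrite inE => /orP[/eqP ->|r's] r'q.
  by case: iP; apply: r'q; rewrite leq_maxr.
by apply: IHs => // j jn; apply: r'q; rewrite leq_max jn.
Qed.

Lemma iter_chen_tail n (q : chen_basis e) i :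
  chen_val (iter n (@chen_tail E e) q) i = chen_val q (i + n)%N.
Proof. by elim: n i => [|n IHn] i; rewrite ?addn0 //= IHn addSnnS. Qed.

Section Invariant.
Variable U : V -> Prop.
Hypothesis U_act : forall x m, U m -> U (act (twist x) m).

Lemma ghosts_actU l m : U m -> U (ghosts_act l m).
Proof. by elim: l m => //= f l IHl m Um; apply/IHl/U_act. Qed.

(** The ghost of a long prefix of one path in the support of [m] kills all other
    terms of [m].  Taking for this prefix the stem of the path followed by turns of
    the cycle leaves exactly [e^oo]. *)
Lemma invariant_chen_inf m : m != 0 -> U m ->
  exists2 b : S, b != 0 & U (b *: << chen_inf e >>).
Proof.
move=> m0 Um; have [ms0|[q qm]] := fset_0Vmem (msupp m).
  by case/eqP: m0; rewrite [m]monalgE ms0 big_seq_fset0.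
have [n nP] := prefix_separation q (msupp m).
(* Whole turns after the stem make the remaining path start again at [e_1]; there
   are at least [n] of them, and each has positive length. *)
pose d := (n * size C + size (stem q))%N; pose l := mkseq q d.
have [b b0 bP] := ghosts_act_basis l; exists (m@_q * b).
  by rewrite mulf_neq0 // mcoeff_neq0.
have <- : iter d (@chen_tail E e) q = chen_inf e; last first.
  have := ghosts_actU l Um.
  rewrite ghosts_act_sum (bigD1_seq q) //= big_seq_cond big1 => [|r].
    by rewrite addr0 bP size_mkseq eqxx scalerA.
  case/andP=> rm rq; rewrite bP; case: ifP; last by rewrite scaler0.
  rewrite size_mkseq => /eqP lE; case/eqP: rq; apply: nP rm _ => i i_n.
  have id : (i < d)%N.
    by rewrite (leq_trans i_n) // (leq_trans _ (leq_addr _ _)) // leq_pmulr.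
  by rewrite -(nth_mkseq (chen_val q 0) r id) -lE nth_mkseq.
apply: val_inj; apply/funext => i; rewrite /= [LHS]iter_chen_tail stemE.
rewrite /d addnA /icat ltnNge leq_addl /= addnK.
by rewrite /cycle_inf addnC modnMDl.
Qed.

Lemma invariant_full m : m != 0 -> U m -> forall m', U m'.
Proof.
move=> m0 Um m'; have [b b0 Ub] := invariant_chen_inf m0 Um.
have [f fb] := eval_surj b^-1; have [l <-] := twisted_eval_surj m'.
apply: U_act; have := U_act (ev f) Ub; rewrite chen_actZr -/(twisted_eval _).
rewrite -(vertex_cycle_eval e f) twisted_evalMeval twisted_eval_vertex fb scalerA.
by rewrite mulfV // scale1r.
Qed.

End Invariant.

End Irreducibility.

(** * The resolution *)

Section Resolution.
Variables (K : fieldType) (E : digraph) (e : graph_cycle E).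
Variables (p : {poly K}) (hp : basic_irreducible p).
Local Notation L := (leavitt K E).
Local Notation v := (cycle_src e).
Local Notation pow := (@cycle_power K E e).
Local Notation ev := (@cycle_eval K E e).

(** Modulo multiples of [p(e)], the vertex [v] is a multiple of every power of
    the cycle; so right multiplication by a power of the cycle loses nothing. *)
Lemma vertex_split m :
  exists f u, lvertex K v = pow m ** ev f - ev p ** ev u.
Proof.
have [g /(_ m)[u gE]] := basic_irreducible_inverse hp.
exists (g ^+ m), u; rewrite -cycle_evalXn -!cycle_evalM gE cycle_evalD.
by rewrite cycle_eval1 addrK.
Qed.

(** After right multiplication by a power of the cycle, [r] becomes a normal form
    killed by [p(e)].  Evaluated with a transcendental twist, its image is killed by
    the nonzero scalar [p(x)], so all its polynomials vanish.  Hence [r] is killed by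
    a power of the cycle as well as by [p(e)], and [v] is a combination of these
    two. *)
Lemma cycle_eval_regular (r : L) : r ** ev p = 0 -> r ** lvertex K v = 0.
Proof.
move=> rp; have [m [h hE]] := eventually_normalP e r.
(* Polynomials in the cycle commute, so the power of the cycle can be moved past
   [p(e)]. *)
have h0 : normal_form h = 0.
  have : normal_form h ** ev p = 0.
    by rewrite -hE -rng_mulA -cycle_evalXn cycle_evalC rng_mulA rp rng_mul0r.
  move=> /(congr1 (twisted_eval (frac_const K) e (frac_X_neq0 K))).
  rewrite twisted_evalMeval twisted_eval0 frac_eval => /eqP.
  rewrite scaler_eq0 tofrac_eq0.
  have [[sp _] _ _] := hp; rewrite -size_poly_eq0 gtn_eqF ?(ltn_trans _ sp) //=.
  move=> /eqP /twisted_eval_normal_form_eq0 hq.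
  suff -> : h = 0 by exact: normal_form0.
  apply/malgP => q; apply/eqP; rewrite mcoeff0 -tofrac_eq0 -frac_eval.
  by rewrite hq.
have [f [u ->]] := vertex_split m.
by rewrite rng_mulDr rng_mulrN !rng_mulA hE h0 rp !rng_mul0r subr0.
Qed.

Local Notation twisted_eval := (twisted_eval (residue_const hp) e (xbar_neq0 hp)).

Lemma twisted_eval_cycle_eval (r : L) : twisted_eval (r ** ev p) = 0.
Proof. by rewrite twisted_evalMeval residue_eval_root scale0r. Qed.

(** A power of the cycle turns [r] into a normal form, still in the kernel.  All of
    its polynomials vanish at [xbar], so they are divisible by [p] and the normal
    form lies in [L p(e)].  The power of the cycle is then removed with
    [vertex_split]. *)
Lemma twisted_eval_kernel (r : L) :
  twisted_eval r = 0 -> exists y, r ** lvertex K v = y ** ev p.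
Proof.
move=> r0; have [m [h hE]] := eventually_normalP e r.
have h0 : twisted_eval (normal_form h) = 0.
  by rewrite -hE -cycle_evalXn twisted_evalMeval r0 scaler0.
have [y yE] : exists y, normal_form h = y ** ev p.
  rewrite /normal_form; elim/big_ind: _ => [|x y [x' ->] [y' ->]|q _].
  - by exists 0; rewrite rng_mul0r.
  - by exists (x' + y'); rewrite rng_mulDl.
  have [u ->] := residue_eval_eq0 (twisted_eval_normal_form_eq0 h0 q).
  by eexists; rewrite cycle_evalM rng_mulA.
have [f [u ->]] := vertex_split m; exists (y ** ev f - r ** ev u).
rewrite rng_mulDr rng_mulrN rng_mulA hE yE rng_mulDl rng_mulNr.
by rewrite -!rng_mulA [ev f ** _]cycle_evalC [ev u ** _]cycle_evalC.
Qed.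

Lemma twisted_eval_vertex_surj (m : twisted_chen e hp) :
  exists l, twisted_eval (l ** lvertex K v) = m.
Proof.
have [l <-] := twisted_eval_surj (xbar_neq0 hp) (@residue_eval_surj K p hp) m.
by exists l; rewrite twisted_evalM twisted_eval_vertex.
Qed.

Lemma twisted_chen_unital : unital (twisted_chen e hp).
Proof.
move=> m; have [l <-] := twisted_eval_vertex_surj m.
exists [:: (l, twisted_eval (lvertex K v) : twisted_chen e hp)].
by rewrite big_seq1 twisted_evalM.
Qed.

Lemma twisted_chen_simple : simple_module (twisted_chen e hp).
Proof.
split; first exact: twisted_chen_unital.
  exists (twisted_eval (lvertex K v) : twisted_chen e hp).
  by rewrite twisted_eval_vertex monalgU_eq0 oner_neq0.
move=> U [U0 _ UA].
have [[m [Um m0]]|Unone] := EM (exists m, U m /\ m != 0).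
  right; exact: (invariant_full (@residue_eval_surj K p hp) UA m0 Um).
by left=> m Um; apply/eqP; apply: contra_notT Unone => m0; exists m.
Qed.

End Resolution.

Theorem theorem4p3 (K : fieldType) (E : digraph) (e : graph_cycle E)
    (p : {poly K}) (hp : basic_irreducible p) :
  [/\ simple_module (twisted_chen e hp),
      finitely_presented (twisted_chen e hp),
      projective (left_ideal (cycle_eval e p)),
      projective (left_ideal (lvertex K (cycle_src e))) &
      @short_exact (leavitt K E)
        (left_ideal (cycle_eval e p))
        (left_ideal (lvertex K (cycle_src e)))
        (twisted_chen e hp)
        (left_incl (cycle_eval_left_mult e p))
        (fun l => rho_inf e
           (gauge e (xbar_neq0 hp)
              (base_change (residue_const hp) E (left_val l))))].
Proof.
have vv := lvertexK K (cycle_src e).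
have vp := vertex_cycle_eval e p.
have proj_p := left_ideal_projective vp vv (@cycle_eval_regular K E e p hp).
have proj_v := left_ideal_projective vv vv (fun r rv => rv).
pose g (l : left_ideal (lvertex K (cycle_src e))) : twisted_chen e hp :=
  twisted_eval (residue_const hp) e (xbar_neq0 hp) (left_val l).
have exact_g : short_exact (left_incl (cycle_eval_left_mult e p)) g.
  split.
  - by split=> [x y|x y]; apply: val_inj.
  - by split=> [x y|x y]; [exact: twisted_evalD|exact: twisted_evalM].
  - by move=> x y /(congr1 (@left_val _ _)) xy; apply: val_inj.
  - move=> y; split=> [/twisted_eval_kernel[z zE]|[[x xP] <-]].
      have yv : left_val y ** lvertex K (cycle_src e) = left_val y.
        by have /asboolP[r ->] := left_valP y; rewrite -rng_mulA vv.
      have yp : left_val y \in left_mult (cycle_eval e p).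
        by apply/asboolP; exists z; rewrite -zE yv.
      by exists (LeftIdeal yp); apply: val_inj.
    by have /asboolP[r xE] := xP; rewrite /g /= xE; exact: twisted_eval_cycle_eval.
  move=> m; have [l lE] := twisted_eval_vertex_surj m.
  have lP : l ** lvertex K (cycle_src e) \in left_mult (lvertex K (cycle_src e)).
    by apply/asboolP; exists l.
  by exists (LeftIdeal lP).
split=> //; first exact: twisted_chen_simple.
split; first exact: twisted_chen_unital.
exists (left_ideal (cycle_eval e p)), (left_ideal (lvertex K (cycle_src e))).
exists (left_incl (cycle_eval_left_mult e p)), g; split=> //.
- exact: left_ideal_finitely_generated vv.
- exact: left_ideal_unital vp.
- exact: left_ideal_finitely_generated vp.
Qed.
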